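(* Let $M$ be an oriented four-manifold and let $\mathcal{D}=(\Sigma,\Xi)$ be a scalar-electromagnetic structure with $\Sigma=(\mathcal{M},\mathcal{G},\Phi)$ and $\Xi=(\mathcal{S},D,J,\omega)$. Let $\Delta=(\mathcal{S},D,\omega)$ be the underlying duality structure and $\mathcal{D}_0=(\Sigma,\Delta)$ the underlying scalar-duality structure. Then for any Lorentzian metric $g$ on $M$ and any scalar-electromagnetic duality transformation $f\in \mathrm{Aut}(\mathcal{D}_0)$, we have $$f\diamond \mathrm{Sol}^g_{\mathcal{D}}(M)=\mathrm{Sol}^g_{\mathcal{D}_f}(M).$$
   Context: All manifolds are smooth, connected, Hausdorff and paracompact; bundles, sections and maps are smooth. Lorentzian means signature $(3,1)$ (mostly plus). Structures. A scalar structure $\Sigma=(\mathcal{M},\mathcal{G},\Phi)$ is a Riemannian manifold $(\mathcal{M},\mathcal{G})$ with $\Phi\in C^\infty(\mathcal{M},\mathbb{R})$; $\mathrm{Aut}(\Sigma)$ is the group of isometries $\psi$ of $(\mathcal{M},\mathcal{G})$ with $\Phi\circ\psi=\Phi$. A duality structure $\Delta=(\mathcal{S},D,\omega)$ on $\mathcal{M}$ is a real vector bundle $\mathcal{S}$ with a fiberwise symplectic pairing $\omega$ and a flat connection $D$ compatible with $\omega$: $X(\omega(\xi_1,\xi_2))=\omega(D_X\xi_1,\xi_2)+\omega(\xi_1,D_X\xi_2)$. A taming $J$ of $(\mathcal{S},\omega)$ is $J\in\Gamma(\mathcal{M},End(\mathcal{S}))$ with $J^2=-\mathrm{id}$, $\omega(J\xi_1,J\xi_2)=\omega(\xi_1,\xi_2)$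 and $Q_{J,\omega}(\xi_1,\xi_2):=\omega(J\xi_1,\xi_2)$ positive-definite; $J$ need not be $D$-parallel. $\Xi=(\mathcal{S},D,J,\omega)$ is then an electromagnetic structure, and $\mathcal{D}=(\Sigma,\Xi)$ a scalar-electromagnetic structure. Fundamental field. $\Theta_\Xi\in\Omega^1(\mathcal{M},End(\mathcal{S}))$ is $\Theta_\Xi(X)=D_X\circ J-J\circ D_X$, and $\Psi_{\mathcal{D}}:=(\sharp_{\mathcal{G}}\otimes\mathrm{id})(\Theta_\Xi)\in\Gamma(\mathcal{M},T\mathcal{M}\otimes End(\mathcal{S}))$, where $\sharp_{\mathcal{G}}:T^*\mathcal{M}\to T\mathcal{M}$ is the musical isomorphism. Configurations and solutions. A superscript $\varphi$ denotes pull-back of bundles, sections and connections along $\varphi:M\to\mathcal{M}$. $\mathrm{Conf}^g_{\mathcal{D}}(M)$ is the set of pairs $(\varphi,\mathcal{V})$ with $\varphi\in C^\infty(M,\mathcal{M})$ and $\mathcal{V}\in\Omega^2(M,\mathcal{S}^\varphi)$ satisfying $\ast_g\mathcal{V}=-J^\varphi\mathcal{V}$, where the Hodge operator $\ast_g$ of $(M,g)$ acts on the form factor. $\mathrm{Sol}^g_{\mathcal{D}}(M)$ is the subset of those pairs satisfying (i) $\theta_\Sigma(g,\varphi)-\tfrac12(\ast_g\mathcal{V},\Psi_{\mathcal{D}}^\varphi\mathcal{V})=0$, (ii) $\mathrm{d}_{D^\varphi}\mathcal{V}=0$, where $\mathrm{d}_{D^\varphi}$ is the exterior differential twisted by $D^\varphi$;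 $\theta_\Sigma(g,\varphi):=\mathrm{Tr}_g\nabla \mathrm{d}\varphi-(\mathrm{grad}_{\mathcal{G}}\Phi)^\varphi\in\Gamma(M,(T\mathcal{M})^\varphi)$ with $\nabla$ the connection on $T^*M\otimes(T\mathcal{M})^\varphi$ induced by the Levi-Civita connections of $g$ and $\mathcal{G}$; and $(\cdot,\cdot)$ is the pairing on $\wedge T^*M\otimes\mathcal{S}^\varphi$ with $(\rho_1\otimes\xi_1,\rho_2\otimes\xi_2)=(\rho_1,\rho_2)_g\,Q_{J,\omega}^\varphi(\xi_1,\xi_2)$, where $(\cdot,\cdot)_g$ is induced by $g$ on $\wedge T^*M$, trivially extended so that a factor in $(T\mathcal{M})^\varphi$ is carried along as a spectator (so $(\ast_g\mathcal{V},\Psi^\varphi_{\mathcal{D}}\mathcal{V})\in\Gamma(M,(T\mathcal{M})^\varphi)$). Dualities. An unbased automorphism $f$ of $\mathcal{S}$ is a diffeomorphism $f:\mathcal{S}\to\mathcal{S}$ covering a diffeomorphism $f_0$ of $\mathcal{M}$ with linear fiber maps $f_p:\mathcal{S}_p\to\mathcal{S}_{f_0(p)}$. $\mathrm{Aut}^{ub}(\Delta)$ is the group of unbased automorphisms that are symplectic (each $f_p$ is a symplectic isomorphism $(\mathcal{S}_p,\omega_p)\to(\mathcal{S}_{f_0(p)},\omega_{f_0(p)})$) and covariantly constant ($D_{(f_0)_*X}\,\mathbf{f}(\xi)=\mathbf{f}(D_X\xi)$ for all $X,\xi$, where $\mathbf{f}(\xi)=f\circ\xi\circ f_0^{-1}$).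 $\mathrm{Aut}(\mathcal{D}_0):=\{f\in\mathrm{Aut}^{ub}(\Delta)\mid f_0\in\mathrm{Aut}(\Sigma)\}$; its elements are the scalar-electromagnetic dualities. For such $f$, $\mathcal{D}_f:=(\Sigma,\Xi_f)$ with $\Xi_f:=(\mathcal{S},D,\mathbf{Ad}(f)(J),\omega)$, where $\mathbf{Ad}(f)(J)_{f_0(p)}=f_p\circ J_p\circ f_p^{-1}$ (again a taming). The group $\mathrm{Aut}(\mathcal{D}_0)$ acts on the union over all tamings $J'$ of $(\mathcal{S},\omega)$ of the sets $\mathrm{Conf}^g_{(\Sigma,(\mathcal{S},D,J',\omega))}(M)$ by $f\diamond(\varphi,\mathcal{V}):=(f_0\circ\varphi,\hat f^\varphi(\mathcal{V}))$, where $\hat f:\mathcal{S}\to\mathcal{S}^{f_0}$ is the based bundle isomorphism with $\hat f_p=f_p$, and $\hat f^\varphi:\mathcal{S}^\varphi\to\mathcal{S}^{f_0\circ\varphi}$ is its pull-back, acting trivially on the form factor. *)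

(* Defs.v *)
From HB Require Import structures.
From mathcomp Require Import all_boot all_order all_algebra.
From mathcomp Require Import all_classical all_reals topology normedtype derive.

Set Implicit Arguments.
Unset Strict Implicit.
Unset Printing Implicit Defensive.
Import Order.TTheory GRing.Theory Num.Theory.
Import numFieldNormedType.Exports.
Local Open Scope classical_set_scope.
Local Open Scope ring_scope.

Notation "''e_' i" := (delta_mx 0 i) (at level 8, i at level 2, format "''e_' i").

(** * Smooth maps between open sets of normed spaces *)

Section Smooth.
Context {R : realType} {V W : normedModType R}.

(* On an open set, f is C^(k+1) iff f is (Frechet) differentiable with
   C^k directional derivatives (V is finite-dimensional in all uses). *)
Fixpoint Ck (k : nat) (U : set V) (f : V -> W) : Prop :=
  if k is k'.+1 then
    (forall x, U x -> differentiable f x) /\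
    (forall v : V, Ck k' U (fun x => 'D_v f x))
  else forall x, U x -> {for x, continuous f}.

Definition Csmooth (U : set V) (f : V -> W) : Prop := forall k, Ck k U f.

End Smooth.

(** * Manifolds *)

Definition paracompact (T : topologicalType) : Prop :=
  forall C : set (set T),
    (forall A, C A -> open A) -> (forall x, exists2 A, C A & A x) ->
  exists C' : set (set T),
    [/\ forall B, C' B -> open B,
        forall x, exists2 B, C' B & B x,
        forall B, C' B -> exists2 A, C A & B `<=` A &
        forall x : T, exists2 O, nbhs x O &
          finite_set [set B | C' B /\ B `&` O !=set0]].

(* A homeomorphism from an open subset [cdom] of T onto an open subset of R^n;
   both maps are total, with junk values outside these sets. *)
Record chart (R : realType) (T : topologicalType) (n : nat) := Chart {
  cdom : set T;
  cmap : T -> 'rV[R]_n;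
  cinv : 'rV[R]_n -> T;
  cdom_open : open cdom;
  cmap_open : open (cmap @` cdom);
  cmapK : forall x, cdom x -> cinv (cmap x) = x;
  cmap_cont : forall x, cdom x -> {for x, continuous cmap};
  cinv_cont : forall y, (cmap @` cdom) y -> {for y, continuous cinv}
}.

(* A smooth structure is given by a smooth atlas indexed by the points of the
   manifold, [chart_at p] being a chart around p. *)
Record manifold (R : realType) (n : nat) := Manifold {
  carrier :> topologicalType;
  chart_at : carrier -> chart R carrier n;
  chart_at_self : forall p, cdom (chart_at p) p;
  chart_at_smooth : forall p q,
    Csmooth (cmap (chart_at p) @` (cdom (chart_at p) `&` cdom (chart_at q)))
            (cmap (chart_at q) \o cinv (chart_at p));
  man_hausdorff : hausdorff_space carrier;
  man_connected : connected [set: carrier];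
  man_paracompact : paracompact carrier
}.

Section ManifoldTheory.
Context {R : realType} {n : nat} {M : manifold R n}.
Implicit Types p q x : M.

Definition mdom p := cdom (chart_at p).
Definition mchart p := cmap (chart_at p).
Definition minv p := cinv (chart_at p).

Definition smooth_on (W : normedModType R) (U : set M) (h : M -> W) : Prop :=
  forall p, Csmooth (mchart p @` (U `&` mdom p)) (h \o minv p).

(* The tangent space at p is R^n, a vector standing for its components in
   [chart_at p]; this is the differential at p of a vector-valued function. *)
Definition mdiff (W : normedModType R) (h : M -> W) p : {linear 'rV[R]_n -> W} :=
  'd (h \o minv p) (mchart p p).

End ManifoldTheory.

(* An orientation is encoded by the atlas being positively oriented, so that the
   standard basis of every tangent space R^n is positive. *)
Record oriented_manifold (R : realType) (n : nat) := OrientedManifold {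
  oman :> manifold R n;
  oman_pos : forall p q x : oman, mdom p x -> mdom q x ->
    0 < \det ('J (mchart q \o minv p) (mchart p x))
}.

Section SmoothMaps.
Context {R : realType} {m n : nat} {M : manifold R m} {N : manifold R n}.

Definition smooth_map (phi : M -> N) : Prop :=
  continuous phi /\
  forall q : N, smooth_on (phi @^-1` mdom q) (mchart q \o phi).

Definition tmap (phi : M -> N) (p : M) : {linear 'rV[R]_m -> 'rV[R]_n} :=
  mdiff (mchart (phi p) \o phi) p.

End SmoothMaps.

(** * Vector bundles *)

(* A family of vector spaces with local trivialisations [btriv i] over [bdom i]
   (indexed, like charts, by points) and their inverses [bframe i]; the frame
   i consists of the local sections  x |-> bframe i x 'e_a. *)
Record bundle_data (R : realType) (n : nat) (M : manifold R n) := BundleData {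
  bfib :> M -> lmodType R;
  brank : nat;
  bdom : M -> set M;
  btriv : forall i x : M, {linear bfib x -> 'rV[R]_brank};
  bframe : forall i x : M, {linear 'rV[R]_brank -> bfib x}
}.

Record vector_bundle (R : realType) (n : nat) (M : manifold R n) := VectorBundle {
  vbdata :> bundle_data M;
  bdom_open : forall i : M, open (bdom vbdata i);
  bdom_self : forall i : M, bdom vbdata i i;
  btrivK : forall i x, bdom vbdata i x ->
    cancel (btriv vbdata i x) (bframe vbdata i x);
  bframeK : forall i x, bdom vbdata i x ->
    cancel (bframe vbdata i x) (btriv vbdata i x);
  btrans_smooth : forall i j w,
    smooth_on (bdom vbdata i `&` bdom vbdata j)
              (fun x => btriv vbdata j x (bframe vbdata i x w))
}.

Section Sections.
Context {R : realType} {m n : nat} {M : manifold R m} {N : manifold R n}.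

Definition smooth_section (B : bundle_data M) (U : set M)
    (s : forall x, B x) : Prop :=
  forall i, smooth_on (U `&` bdom B i) (fun x => btriv B i x (s x)).

End Sections.

Section Tangent.
Context {R : realType} {n : nat}.

(* Trivialisation i sends a tangent vector at x to its components in the chart
   around i, so [bframe (TM M) i x v] is the vector at x with components v in that
   chart. *)
Definition TM (M : manifold R n) : bundle_data M :=
  @BundleData R n M (fun _ => 'rV[R]_n) n mdom
    (fun i x => mdiff (mchart i) x)
    (fun i x => 'd (mchart x \o minv i) (mchart i x)).

Context {M : manifold R n}.

(* The vector field around p with constant components v in [chart_at p]. *)
Definition cfield (p : M) (v : 'rV[R]_n) (x : M) : 'rV[R]_n := bframe (TM M) p x v.

Definition lie_bracket (X Y : M -> 'rV[R]_n) (p : M) : 'rV[R]_n :=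
  mdiff (fun x => btriv (TM M) p x (Y x)) p (X p)
  - mdiff (fun x => btriv (TM M) p x (X x)) p (Y p).

End Tangent.

(** * Connections *)

(* [cov p v xi] is D_v xi at p; it is meaningful for sections xi that are smooth
   around p, so that connections apply to local sections. *)
Record connection (R : realType) (n : nat) (M : manifold R n)
    (B : vector_bundle M) := Connection {
  cov :> forall p : M, 'rV[R]_n -> (forall x, B x) -> B p;
  cov_linear : forall U p xi, open U -> U p -> smooth_section U xi ->
    linear (fun v => cov p v xi);
  covD : forall U p v xi eta, open U -> U p ->
    smooth_section U xi -> smooth_section U eta ->
    cov p v (fun x => xi x + eta x) = cov p v xi + cov p v eta;
  cov_leibniz : forall U p v (h : M -> R^o) xi, open U -> U p ->
    smooth_on U h -> smooth_section U xi ->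
    cov p v (fun x => h x *: xi x) = mdiff h p v *: xi p + h p *: cov p v xi;
  cov_smooth : forall U (X : M -> 'rV[R]_n) xi, open U ->
    smooth_section (B := TM M) U X -> smooth_section U xi ->
    smooth_section U (fun x => cov x (X x) xi)
}.

Definition flat (R : realType) (n : nat) (M : manifold R n)
    (B : vector_bundle M) (D : connection B) : Prop :=
  forall U (X Y : M -> 'rV[R]_n) (xi : forall x, B x) p, open U -> U p ->
    smooth_section (B := TM M) U X -> smooth_section (B := TM M) U Y ->
    smooth_section U xi ->
  D p (X p) (fun x => D x (Y x) xi) - D p (Y p) (fun x => D x (X x) xi)
    - D p (lie_bracket X Y p) xi = 0.

Section Pullback.
Context {R : realType} {m n : nat} {M : manifold R m} {N : manifold R n}.
Variables (B : bundle_data N) (nabla : forall q : N, 'rV[R]_n -> (forall y, B y) -> B q).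

(* The pulled-back connection, determined by
   nabla^phi_v (h e^phi) = dh(v) e(phi p) + h(p) nabla_{dphi(v)} e,
   computed by expanding the section s of B^phi in the frame around phi p. *)
Definition pullback_cov (phi : M -> N) (p : M) (v : 'rV[R]_m)
    (s : forall x : M, B (phi x)) : B (phi p) :=
  let s' x := btriv B (phi p) (phi x) (s x) in
  \sum_a (mdiff s' p v 0 a *: bframe B (phi p) (phi p) 'e_a
          + s' p 0 a *: nabla (phi p) (tmap phi p v) (fun y => bframe B (phi p) y 'e_a)).

End Pullback.
Arguments pullback_cov {R m n M N B} nabla phi p v s.

(** * Metrics *)

Section Metric.
Context {R : realType} {n : nat} {M : manifold R n}.

(* Gram matrix of the metric in the basis of the tangent space R^n. *)
Definition gram_field := M -> 'M[R]_n.

Definition ip (g : gram_field) (p : M) (u v : 'rV[R]_n) : R :=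
  (u *m g p *m v^T) 0 0.

Definition smooth_symmetric (g : gram_field) : Prop :=
  (forall p, (g p)^T = g p) /\
  (forall p u v, smooth_on (mdom p)
    (fun x => ip g x (cfield p u x) (cfield p v x) : R^o)).

Definition riemannian (g : gram_field) : Prop :=
  smooth_symmetric g /\ forall p u, u != 0 -> 0 < ip g p u u.

(* Koszul formula for 2 g(nabla_u v, w) on fields with constant components in
   [chart_at p], whose brackets vanish. *)
Definition koszul (g : gram_field) (p : M) (u v w : 'rV[R]_n) : R :=
  let dg (a b c : 'rV[R]_n) : R :=
    mdiff (fun x => ip g x (cfield p b x) (cfield p c x) : R^o) p a in
  dg u v w + dg v u w - dg w u v.

(* Musical isomorphism on covectors given by their components. *)
Definition sharp (g : gram_field) (p : M) (alpha : 'rV[R]_n) : 'rV[R]_n :=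
  alpha *m invmx (g p).

(* In components: u^i d_i X^k + Gamma^k_ij u^i X^j in [chart_at p]. *)
Definition levi_civita (g : gram_field) (p : M) (u : 'rV[R]_n)
    (X : M -> 'rV[R]_n) : 'rV[R]_n :=
  mdiff (fun x => btriv (TM M) p x (X x)) p u
  + sharp g p (\row_i (2^-1 * koszul g p u (X p) 'e_i)).

Definition grad (g : gram_field) (h : M -> R^o) (p : M) : 'rV[R]_n :=
  sharp g p (\row_i mdiff h p 'e_i).

End Metric.

Definition lorentzian (R : realType) (M : manifold R 4) (g : M -> 'M[R]_4) : Prop :=
  smooth_symmetric g /\
  forall p, exists2 P : 'M[R]_4, P \in unitmx &
    P *m g p *m P^T = diag_mx (\row_(i < 4) (if i == 0 then -1 else 1)).

Section TensionField.
Context {R : realType} {m n : nat} {M : manifold R m} {N : manifold R n}.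
Variables (g : M -> 'M[R]_m) (G : N -> 'M[R]_n) (phi : M -> N).

(* (nabla dphi)(u, v) = nabla^phi_u (dphi v) - dphi (nabla_u v), v being
   extended with constant components (the value is independent of this). *)
Definition hessian (p : M) (u v : 'rV[R]_m) : 'rV[R]_n :=
  pullback_cov (B := TM N) (levi_civita G) phi p u (fun x => tmap phi x (cfield p v x))
  - tmap phi p (levi_civita g p u (cfield p v)).

Definition tension (p : M) : 'rV[R]_n :=
  \sum_a \sum_b invmx (g p) a b *: hessian p 'e_a 'e_b.

End TensionField.

(** * Bundle-valued two-forms on an oriented Lorentzian four-manifold *)

Section TwoForms.
Context {R : realType} {M : manifold R 4} (g : M -> 'M[R]_4) {W : lmodType R}.
Implicit Types (p : M) (alpha beta : 'rV[R]_4 -> 'rV[R]_4 -> W).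

Definition volume p (u1 u2 u3 u4 : 'rV[R]_4) : R :=
  Num.sqrt `|\det (g p)| *
  \det (\matrix_(i < 4) nth 0 [:: u1; u2; u3; u4] i : 'M[R]_4).

(* star(beta)_cd = 1/2 beta^ab vol_abcd, i.e. alpha /\ star(beta) = (alpha, beta)_g vol. *)
Definition hodge p beta (u v : 'rV[R]_4) : W :=
  2^-1 *: \sum_a \sum_b \sum_c \sum_d
    (invmx (g p) a c * invmx (g p) b d * volume p 'e_a 'e_b u v)
      *: beta 'e_c 'e_d.

(* Normalised so that (t1 /\ t2, t1' /\ t2')_g = det (ti, tj')_g. *)
Definition form_pairing p (Q : W -> W -> R) alpha beta : R :=
  2^-1 * \sum_a \sum_b \sum_c \sum_d
    invmx (g p) a c * invmx (g p) b d * Q (alpha 'e_a 'e_b) (beta 'e_c 'e_d).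

End TwoForms.

(** * Scalar-electromagnetic structures *)

Record scalar_structure (R : realType) (n : nat) := ScalarStructure {
  sman :> manifold R n;
  smetric : sman -> 'M[R]_n;
  spotential : sman -> R^o;
  smetric_riemannian : riemannian smetric;
  spotential_smooth : smooth_on setT spotential
}.
Arguments smetric {R n} s q : rename.
Arguments spotential {R n} s q : rename.

Record duality_structure (R : realType) (n : nat) (N : manifold R n) := DualityStructure {
  dbundle :> vector_bundle N;
  dconn : connection dbundle;
  dform : forall q : N, dbundle q -> dbundle q -> R;
  dform_linearl : forall q (y : dbundle q), scalar (fun x => dform x y);
  dform_linearr : forall q (x : dbundle q), scalar (dform x);
  dform_alt : forall q (x : dbundle q), dform x x = 0;
  dform_nondeg : forall q (x : dbundle q), (forall y, dform x y = 0) -> x = 0;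
  dform_smooth : forall i v w, smooth_on (bdom dbundle i)
    (fun q => dform (bframe dbundle i q v) (bframe dbundle i q w) : R^o);
  dconn_flat : flat dconn;
  dconn_compat : forall U q v (xi eta : forall x, dbundle x), open U -> U q ->
    smooth_section U xi -> smooth_section U eta ->
    mdiff (fun x => dform (xi x) (eta x) : R^o) q v
    = dform (dconn q v xi) (eta q) + dform (xi q) (dconn q v eta)
}.
Arguments dconn {R n N} d : rename.
Arguments dform {R n N} d q : rename.

Section Electromagnetic.
Context {R : realType} {n : nat} {N : manifold R n} (Delta : duality_structure N).

Definition endo_field := forall q : N, Delta q -> Delta q.

Definition taming_form (J : endo_field) (q : N) (x y : Delta q) : R :=
  dform Delta q (J q x) y.
Arguments taming_form : clear implicits.

Record taming (J : endo_field) : Prop := Taming {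
  taming_linear : forall q, linear (J q);
  taming_smooth : forall i w, smooth_on (bdom Delta i)
    (fun q => btriv Delta i q (J q (bframe Delta i q w)));
  taming_sq : forall q x, J q (J q x) = - x;
  taming_symp : forall q x y, dform Delta q (J q x) (J q y) = dform Delta q x y;
  taming_pos : forall q x, x != 0 -> 0 < taming_form J q x x
}.

(* Theta(v) = D_v o J - J o D_v at q, evaluated on x by extending x to a section
   with constant components in a local frame (the value is independent of this). *)
Definition Theta (J : endo_field) (q : N) (v : 'rV[R]_n) (x : Delta q) : Delta q :=
  let xi y := bframe Delta q y (btriv Delta q q x) in
  dconn Delta q v (fun y => J y (xi y)) - J q (dconn Delta q v xi).

(* Psi = \sum_i d_i (x) Psi_i as an element of T_q N (x) End(S_q). *)
Definition Psi (G : N -> 'M[R]_n) (J : endo_field) (q : N) (i : 'I_n)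
    (x : Delta q) : Delta q :=
  \sum_j invmx (G q) i j *: Theta J 'e_j x.

End Electromagnetic.
Arguments taming_form {R n N Delta} J q x y.

(** * Configurations and solutions *)

Section Solutions.
Context {R : realType} {n : nat} (M : oriented_manifold R 4).
Context (Sigma : scalar_structure R n) (Delta : duality_structure Sigma).

Definition twoform_along (phi : M -> Sigma) : Type :=
  forall p : M, 'rV[R]_4 -> 'rV[R]_4 -> Delta (phi p).

Definition preconf : Type := {phi : M -> Sigma & twoform_along phi}.

Definition smooth_twoform (phi : M -> Sigma) (V : twoform_along phi) : Prop :=
  [/\ forall p v, linear (V p ^~ v),
      forall p u, linear (V p u),
      forall p u, V p u u = 0 &
      forall p i u v, smooth_on (mdom p `&` phi @^-1` bdom Delta i)
        (fun x => btriv Delta i (phi x) (V x (cfield p u x) (cfield p v x)))].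

(* Invariant formula for the exterior differential twisted by D^phi. *)
Definition twisted_d (phi : M -> Sigma) (V : twoform_along phi)
    (X Y Z : M -> 'rV[R]_4) (p : M) : Delta (phi p) :=
  let D := pullback_cov (dconn Delta) phi p in
    D (X p) (fun x => V x (Y x) (Z x))
  + D (Y p) (fun x => V x (Z x) (X x))
  + D (Z p) (fun x => V x (X x) (Y x))
  - V p (lie_bracket X Y p) (Z p)
  - V p (lie_bracket Y Z p) (X p)
  - V p (lie_bracket Z X p) (Y p).

Definition Conf (J : endo_field Delta) (g : M -> 'M[R]_4) : set preconf :=
  [set c | let: existT phi V := c in
    [/\ smooth_map phi, smooth_twoform V &
        forall p u v, hodge g p (V p) u v = - J (phi p) (V p u v)]].

(* The pairing (star_g V, Psi^phi V), with values in the tangent space at phi p. *)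
Definition Psi_pairing (J : endo_field Delta) (g : M -> 'M[R]_4)
    (phi : M -> Sigma) (V : twoform_along phi) (p : M) : 'rV[R]_n :=
  \row_i form_pairing g p (taming_form J (phi p)) (hodge g p (V p))
           (fun u v => Psi (smetric Sigma) J i (V p u v)).

Definition Sol (J : endo_field Delta) (g : M -> 'M[R]_4) : set preconf :=
  [set c | Conf J g c /\
    let: existT phi V := c in
    (forall p, tension g (smetric Sigma) phi p
               - grad (smetric Sigma) (spotential Sigma) (phi p)
               - 2^-1 *: Psi_pairing J g V p = 0) /\
    (forall U X Y Z p, open U -> U p ->
       smooth_section (B := TM M) U X -> smooth_section (B := TM M) U Y ->
       smooth_section (B := TM M) U Z ->
       twisted_d V X Y Z p = 0)].

End Solutions.

(** * Dualities *)

Record bundle_map (R : realType) (n : nat) (N : manifold R n)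
    (S : vector_bundle N) := BundleMap {
  bmbase : N -> N;
  bmfib :> forall q : N, {linear S q -> S (bmbase q)};
  bmbase_smooth : smooth_map bmbase;
  bmfib_smooth : forall i j w,
    smooth_on (bdom S i `&` bmbase @^-1` bdom S j)
      (fun q => btriv S j (bmbase q) (bmfib q (bframe S i q w)))
}.

Definition total_map (R : realType) (n : nat) (N : manifold R n)
    (S : vector_bundle N) (f : bundle_map S) (z : {q : N & S q}) : {q : N & S q} :=
  existT _ (bmbase f (projT1 z)) (f (projT1 z) (projT2 z)).

(* Diffeomorphisms of the total space of S that are linear on fibers and cover a
   diffeomorphism of the base. *)
Record unbased_aut (R : realType) (n : nat) (N : manifold R n)
    (S : vector_bundle N) := UnbasedAut {
  ubmap :> bundle_map S;
  ubinv : bundle_map S;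
  ubmapK : cancel (total_map ubmap) (total_map ubinv);
  ubinvK : cancel (total_map ubinv) (total_map ubmap)
}.

Section Dualities.
Context {R : realType} {n : nat}.

Lemma bmbase_invK (N : manifold R n) (S : vector_bundle N) (f : unbased_aut S) (q : N) :
  bmbase f (bmbase (ubinv f) q) = q.
Proof. by have /(congr1 (@projT1 _ _)) := ubinvK f (existT (fun x => S x) q 0). Qed.

(* The section f o xi o f_0^-1. *)
Definition push_section (N : manifold R n) (S : vector_bundle N) (f : unbased_aut S)
    (xi : forall q, S q) (q : N) : S q :=
  let p := bmbase (ubinv f) q in
  ecast x (S x) (bmbase_invK f q) (f p (xi p)).

Context {Sigma : scalar_structure R n} {Delta : duality_structure Sigma}.
Implicit Type f : unbased_aut Delta.

Definition symplectic f : Prop :=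
  forall q x y, dform Delta (bmbase f q) (f q x) (f q y) = dform Delta q x y.

Definition covariantly_constant f : Prop :=
  forall U (xi : forall q, Delta q) q v, open U -> U q -> smooth_section U xi ->
    dconn Delta (bmbase f q) (tmap (bmbase f) q v) (push_section f xi)
    = f q (dconn Delta q v xi).

Definition scalar_aut (psi : Sigma -> Sigma) : Prop :=
  (forall q u v, ip (smetric Sigma) (psi q) (tmap psi q u) (tmap psi q v)
                 = ip (smetric Sigma) q u v) /\
  (forall q, spotential Sigma (psi q) = spotential Sigma q).

Record em_duality f : Prop := EmDuality {
  em_symplectic : symplectic f;
  em_covconst : covariantly_constant f;
  em_base : scalar_aut (bmbase f)
}.

(* f_p o J_p o f_p^-1 at q = f_0 p. *)
Definition Ad f (J : endo_field Delta) : endo_field Delta :=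
  fun q x =>
    let p := bmbase (ubinv f) q in
    ecast y (Delta y) (bmbase_invK f q) (f p (J p (ubinv f q x))).

Definition duality_action (M : oriented_manifold R 4) f (c : preconf M Delta) :
    preconf M Delta :=
  let: existT phi V := c in
  existT (twoform_along Delta) (bmbase f \o phi)
    (fun p u v => f (phi p) (V p u v)).

End Dualities.

(* Main.v *)
(* All data of a solution are transported by [f].  Since [f] is parallel, the
   pulled-back flat connection along [f_0 o phi] is the image of the one along
   [phi], so the twisted differential of [f V] is [f (d V)], and the fundamental
   form of [Ad f J] is the conjugate of that of [J] (it is tensorial, so it may be
   computed on sections pushed forward by [f]).  Since [f_0] is an isometry, its
   second fundamental form vanishes: differentiating twice the invariance of the
   metric along charts, the Koszul formula and the symmetry of second derivatives
   give [hess f_0 = 0], hence the tension field of [f_0 o phi] is the image of that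
   of [phi].  Both field equations are thus carried to one another by the injective
   maps [f] and [d f_0], and the action of the inverse of [f] gives surjectivity. *)

Require Import Defs.
From HB Require Import structures.
From mathcomp Require Import all_boot all_order all_algebra ring.
From mathcomp Require Import all_classical all_reals topology normedtype landau derive.

Set Implicit Arguments.
Unset Strict Implicit.
Unset Printing Implicit Defensive.
Import Order.TTheory GRing.Theory Num.Theory.
Import numFieldNormedType.Exports.
Local Open Scope classical_set_scope.
Local Open Scope ring_scope.

(** * Differential calculus *)

Section Differential.
Context {R : realType} {V W : normedModType R}.
Implicit Types (f g : V -> W) (h : V -> R^o) (x v : V).

(** A tangent vector is the row of its components in the chart chosen at its own base point, so one
    fixed row denotes unrelated vectors at nearby points. Whatever is differentiated is therefore
    first rewritten through [cfield] and [btriv], in the single chart around the point considered.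
    Sections are total functions of which only the values near a point matter, hence the constant
    passage to germs. The fibers over [f_0 (f_0^-1 q)] and over [q] are identified by a transport,
    present in [push_section] and [Ad]. It disappears at points of the form [f_0 q], and since [f_0]
    is onto it is enough to argue there. The pulled-back connection is defined through one
    particular frame, which [f] does not send to the frame used at the image point, so it must first
    be freed from that choice. The bridge from [hess f_0 = 0] to the tension field is the
    composition rule hess(f_0 o phi) = df_0(hess phi) + hess f_0(dphi, dphi). Transport of solutions
    is proved as an equivalence, so that for the preimage given by the inverse of [f] only
    smoothness remains to be checked. *)

Lemma near_eq_is_diff f g x df :
  (\forall y \near x, f y = g y) -> is_diff x f df -> is_diff x g df.
Proof.
move=> fg [dxf <-].
(* The first-order expansion of [f] at [x] also serves [g], the two remainders being equal near 0;
   uniqueness of the differential then concludes. *)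
have key : g \o shift x = cst (g x) + 'd f x +o_ 0 id.
  have := diff_locally dxf; rewrite -(nbhs_singleton fg) => /eqaddoP fo.
  apply/eqaddoP => e e0; have := fo e e0.
  rewrite !near_simpl; apply: filter_app.
  have : \forall y \near 0, f (y + x) = g (y + x).
    move: fg; rewrite (near_shift 0) /= subr0; exact: filterS.
  by apply: filterS => y yE; rewrite !fctE /= yE.
have cdf : continuous ('d f x) by apply: diff_continuous.
have E : 'd g x = 'd f x :> (V -> W) by apply: diff_unique.
by apply: DiffDef => //; apply/diff_locallyP; split; rewrite E.
Qed.

End Differential.

(** Registered as a bilinear structure so that the product rule can be read off from the
    differential of a bilinear map. *)
Lemma scale_is_bilinear (R : realType) (W : normedModType R) : bilinear_for
  (GRing.Scale.Law.clone _ _ *:%R _) (GRing.Scale.Law.clone _ _ *:%R _)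
  (@GRing.scale R W : R -> W -> W).
Proof.
split => [u a b c|u a b c] /=.
  by rewrite scalerDl scalerA.
by rewrite scalerDr !scalerA mulrC.
Qed.
HB.instance Definition _ (R : realType) (W : normedModType R) :=
  bilinear_isBilinear.Build R R W W _ _ (@GRing.scale R W)
    (@scale_is_bilinear R W).

Section DifferentialScale.
Context {R : realType} {V W : normedModType R}.
Implicit Types (f g : V -> W) (h : V -> R^o) (x v : V).

Lemma is_diff_scale h g x dh dg : is_diff x h dh -> is_diff x g dg ->
  is_diff x (fun y => h y *: g y) (fun v => h x *: dg v + dh v *: g x).
Proof.
move=> dhx dgx.
have -> : (fun y => h y *: g y) = (fun p : R * W => p.1 *: p.2) \o (fun y => (h y, g y)) by [].
have sc : continuous (fun p : R * W => p.1 *: p.2) by move=> ?; apply: scale_continuous.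
have bil : is_diff (h x, g x) (fun p : R * W => p.1 *: p.2)
    (fun q => h x *: q.2 + q.1 *: g x).
  apply: DiffDef; first exact: differentiable_bilin.
  by rewrite diff_bilin.
by apply: is_diff_eq.
Qed.

Lemma is_diff_sum (I : Type) (r : seq I) (P : pred I) (f df : I -> V -> W) x :
  (forall i, is_diff x (f i) (df i)) ->
  is_diff x (fun y => \sum_(i <- r | P i) f i y)
            (fun v => \sum_(i <- r | P i) df i v).
Proof.
move=> dfx; elim: r => [|i r ih].
  rewrite (_ : (fun y => _) = cst 0); last by apply/funext => y; rewrite big_nil.
  apply: is_diff_eq; apply/funext => v; by rewrite big_nil.
rewrite (_ : (fun y => _) =
  (fun y => (if P i then f i y else 0) + \sum_(j <- r | P j) f j y)); last first.
  by apply/funext => y; rewrite big_cons; case: ifP; rewrite ?add0r.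
rewrite (_ : (fun v => \sum_(j <- _ | _) df j v) =
  (fun y => (if P i then df i y else 0) + \sum_(j <- r | P j) df j y)); last first.
  by apply/funext => y; rewrite big_cons; case: ifP; rewrite ?add0r.
apply: is_diffD; case: (P i) => //.
exact: is_diff_cst.
Qed.

Lemma is_diff_differentiable f x df : is_diff x f df -> differentiable f x.
Proof. by case. Qed.

Lemma near_eq_differentiable f g x :
  (\forall y \near x, f y = g y) -> differentiable f x -> differentiable g x.
Proof. by move=> fg /differentiableP dfx; have [] := near_eq_is_diff fg dfx. Qed.

End DifferentialScale.

Section DifferentialRow.
Context {R : realType} {V : normedModType R} {n : nat}.
Implicit Types (f : V -> 'rV[R]_n) (x v : V).

Lemma is_diff_coord f x df i : is_diff x f df ->
  is_diff x (fun y => f y 0 i) (fun v => df v 0 i).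
Proof.
move=> dfx.
have lin : linear (fun N : 'rV[R]_n => N 0 i : R) by move=> a u v; rewrite !mxE.
pose glM := GRing.isLinear.Build _ _ _ _ _ lin.
pose L : {linear 'rV[R]_n -> R} := HB.pack (fun N : 'rV[R]_n => N 0 i : R) glM.
have dL : is_diff (f x) L L.
  have cL : continuous L by exact: coord_continuous.
  by apply: DiffDef; [exact: linear_differentiable|exact: diff_lin].
exact: (is_diff_comp dfx dL).
Qed.

End DifferentialRow.

(** * Calculus of C^k maps *)

Section Ck.
Context {R : realType} {V W : normedModType R}.
Implicit Types (U : set V) (f g : V -> W).

Lemma CkS_Ck k U f : Ck k.+1 U f -> Ck k U f.
Proof.
elim: k U f => [|k ih] U f [df Df].
  by move=> x Ux; apply: differentiable_continuous; apply: df.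
by split => // v; apply: ih; apply: Df.
Qed.

Lemma Ck_subset k U U' f : U' `<=` U -> Ck k U f -> Ck k U' f.
Proof.
move=> sU; elim: k f => [|k ih] f /=; first by move=> cf x /sU; apply: cf.
by move=> [df Df]; split => [x /sU /df//|v]; apply: ih.
Qed.

(** Each clause of [Ck] speaks of one point at a time, so the covering sets may be arbitrary. *)
Lemma Ck_cover k U f :
  (forall x, U x -> exists2 U', U' x & Ck k U' f) -> Ck k U f.
Proof.
elim: k f => [|k ih] f /= cov; first by move=> x /cov [U' U'x]; apply.
split=> [x /cov [U' U'x [df _]]|v]; first exact: df.
by apply: ih => x /cov [U' U'x [_ Df]]; exists U'.
Qed.

(** Openness enters because a derivative at a point sees a whole neighbourhood, on which the two
    maps must agree. *)
Lemma Ck_ext k U f g : open U -> (forall x, U x -> f x = g x) ->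
  Ck k U f -> Ck k U g.
Proof.
move=> oU; have nU x : U x -> nbhs x U by move=> Ux; apply: open_nbhs_nbhs.
elim: k f g => [|k ih] f g fg /=.
  move=> cf x Ux; have fgx : {near x, f =1 g} by apply: filterS (nU x Ux).
  suff : g @ x --> g x by [].
  by rewrite -(fg _ Ux); apply: cvg_trans (cf x Ux); apply: near_eq_cvg.
move=> [df Df]; split=> [x Ux|v].
  by apply: near_eq_differentiable (df x Ux); apply: filterS (nU x Ux).
apply: ih (Df v) => x Ux; apply: near_eq_derive.
by apply: filterS (nU x Ux).
Qed.

Lemma Ck_cst k U (w : W) : Ck k U (fun=> w).
Proof.
elim: k w => [|k ih] w /=; first by move=> x _; apply: cst_continuous.
split=> [x _|v]; first exact: differentiable_cst.
rewrite (_ : 'D_v (fun=> w) = fun=> 0) //.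
by apply/funext => x; apply: derive_cst.
Qed.

Lemma Ck_add k U f g : open U -> Ck k U f -> Ck k U g ->
  Ck k U (fun x => f x + g x).
Proof.
move=> oU; elim: k f g => [|k ih] f g /=.
  by move=> cf cg x Ux; apply: continuousD; [exact: cf|exact: cg].
move=> [df Df] [dg Dg]; split=> [x Ux|v].
  by apply: differentiableD; [exact: df|exact: dg].
apply: Ck_ext (ih _ _ (Df v) (Dg v)) => // x Ux.
by rewrite -deriveD //; apply: diff_derivable; [exact: df|exact: dg].
Qed.

Lemma Ck_sum k U (I : Type) (r : seq I) (P : pred I) (f : I -> V -> W) :
  open U -> (forall i, Ck k U (f i)) ->
  Ck k U (fun x => \sum_(i <- r | P i) f i x).
Proof.
move=> oU cf; elim: r => [|i r ih].
  rewrite (_ : (fun y => _) = fun=> 0); last by apply/funext => y; rewrite big_nil.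
  exact: Ck_cst.
rewrite (_ : (fun y => _) =
  (fun y => (if P i then f i y else 0) + \sum_(j <- r | P j) f j y)); last first.
  by apply/funext => y; rewrite big_cons; case: ifP; rewrite ?add0r.
by apply: Ck_add => //; case: (P i) => //; apply: Ck_cst.
Qed.

End Ck.

Section CkScale.
Context {R : realType} {V W : normedModType R}.
Implicit Types (U : set V) (g : V -> W) (h : V -> R^o).

(** The product rule reproduces products of the same kind, one factor being a derivative and the
    other an original function lowered one degree by [CkS_Ck]; this closes the induction. *)
Lemma Ck_scale k U h g : open U -> Ck k U h -> Ck k U g ->
  Ck k U (fun x => h x *: g x).
Proof.
move=> oU; elim: k h g => [|k ih] h g.
  by move=> ch cg x Ux; apply: continuousZ; [exact: ch|exact: cg].
move=> ch cg; have [dh Dh] := ch; have [dg Dg] := cg.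
have isd x : U x -> is_diff x (fun y => h y *: g y)
    (fun v => h x *: 'd g x v + 'd (h : V -> R^o) x v *: g x).
  move=> Ux; have /differentiableP dhx := dh x Ux.
  have /differentiableP dgx := dg x Ux.
  exact: is_diff_scale.
split=> [x /isd/is_diff_differentiable //|v].
apply: (@Ck_ext _ _ _ _ _ (fun x => h x *: 'D_v g x + 'D_v h x *: g x)) => //.
  move=> x Ux; have [dhg Dhg] := isd _ Ux.
  rewrite [RHS]deriveE // Dhg deriveE; last exact: dg.
  by rewrite deriveE; last exact: dh.
apply: Ck_add => //; first exact: (ih h _ (CkS_Ck ch) (Dg v)).
exact: (ih _ g (Dh v) (CkS_Ck cg)).
Qed.

End CkScale.

Section CkRow.
Context {R : realType} {V : normedModType R} {n : nat}.
Implicit Types (U : set V) (f : V -> 'rV[R]_n).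

Lemma Ck_coord k U f i : open U -> Ck k U f -> Ck k U (fun x => f x 0 i : R^o).
Proof.
move=> oU; elim: k f => [|k ih] f /=.
  move=> cf x Ux; apply: (@continuous_comp _ _ _ f (fun u => u 0 i)).
    exact: cf.
  exact: coord_continuous.
move=> [df Df]; have isd x : U x -> is_diff x (fun y => f y 0 i) (fun v => 'd f x v 0 i).
  by move=> Ux; have /differentiableP := df x Ux; apply: is_diff_coord.
split=> [x /isd/is_diff_differentiable //|v].
apply: Ck_ext (ih _ (Df v)) => // x Ux.
have [dhg Dhg] := isd _ Ux.
rewrite [RHS]deriveE // Dhg deriveE //; exact: df.
Qed.

(** The middle space is a row space so that the chain rule becomes a finite sum of products of a
    coordinate of ['D_v f] and a composite ['D_('e_i) g \o f], to which the induction hypothesis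
    applies. *)
Lemma Ck_comp (W : normedModType R) k (U : set V) (U' : set 'rV[R]_n)
    f (g : 'rV[R]_n -> W) : open U -> U `<=` f @^-1` U' ->
  Ck k U f -> Ck k U' g -> Ck k U (g \o f).
Proof.
move=> oU fU; elim: k g => [|k ih] g.
  move=> cf cg x Ux; apply: continuous_comp; first exact: cf.
  by apply: cg; apply: fU.
move=> cf cg; have [df Df] := cf; have [dg Dg] := cg.
have isd x : U x -> is_diff x (g \o f) ('d g (f x) \o 'd f x).
  move=> Ux; have /differentiableP dhx := df x Ux.
  have /differentiableP dgx := dg _ (fU _ Ux).
  exact: is_diff_comp.
split=> [x /isd/is_diff_differentiable //|v].
apply: (@Ck_ext _ _ _ _ _ (fun x => \sum_i 'D_v f x 0 i *: ('D_('e_i) g \o f) x)) => //.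
  move=> x Ux; have [dgf Dgf] := isd _ Ux.
  rewrite [RHS]deriveE // Dgf /= deriveE; last exact: df.
  rewrite [in RHS](row_sum_delta ('d f x v)) linear_sum; apply: eq_bigr => i _.
  by rewrite linearZ deriveE //; apply: dg; apply: fU.
apply: Ck_sum => // i; apply: Ck_scale => //; first exact: Ck_coord (Df v).
exact: (ih _ (CkS_Ck cf) (Dg _)).
Qed.

End CkRow.

(** * Symmetry of second derivatives *)

Section Schwarz.
Context {R : realType} {V : normedModType R}.
Implicit Types (f : V -> R^o) (a u v : V).

Lemma is_derive_line f a u (t : R) : differentiable f (a + t *: u) ->
  is_derive t (1 : R) (fun s : R => f (a + s *: u)) ('D_u f (a + t *: u)).
Proof.
move=> df.
have : is_diff t (f \o (fun s : R => a + s *: u))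
    ('d f (a + t *: u) \o (fun s : R => 0 + s *: u)).
  have := differentiableP df => ?.
  exact: is_diff_comp.
move=> [dff Dff]; apply: DeriveDef; first exact: diff_derivable.
by rewrite deriveE // Dff /= add0r scale1r deriveE.
Qed.

(** The mean value theorem is used twice: along [u] for the difference of [f] on two parallel
    segments, then along [v] for ['D_u f]. The bound on [h] keeps the whole parallelogram inside the
    ball. *)
Lemma second_difference (r h : R) f a u v :
  0 < h -> h * (`|u| + `|v|) < r -> Ck 2 (ball a r) f ->
  exists2 x, ball a r x &
    f (a + h *: v + h *: u) - f (a + h *: u) - (f (a + h *: v) - f a)
      = h ^+ 2 * 'D_v ('D_u f) x.
Proof.
move=> h0 hr [df /(_ u) [dDf _]].
have inb s t : s \in `[0, h] -> t \in `[0, h] -> ball a r (a + t *: v + s *: u).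
  rewrite !in_itv /= => /andP[s0 sh] /andP[t0 th].
  rewrite -ball_normE /ball_ /= -addrA opprD addrA subrr sub0r normrN.
  apply: le_lt_trans hr; apply: le_trans (ler_normD _ _) _.
  rewrite !normrZ !ger0_norm // mulrDr addrC.
  by apply: lerD; apply: ler_wpM2r.
have z0h : 0 \in `[0, h] by rewrite in_itv /= lexx ltW.
have h0h : h \in `[0, h] by rewrite in_itv /= lexx ltW.
have in0 s : s \in `[0, h] -> ball a r (a + s *: u).
  by move=> sh; have := inb s 0 sh z0h; rewrite scale0r addr0.
pose G (s : R) : R := f (a + h *: v + s *: u) - f (a + s *: u).
pose dG (s : R) : R := 'D_u f (a + h *: v + s *: u) - 'D_u f (a + s *: u).
have GdG s : s \in `[0, h] -> is_derive s (1 : R) G (dG s).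
  move=> sh; apply: is_deriveB; apply: is_derive_line; apply: df.
    exact: inb.
  exact: in0.
have GdGo (s : R) : s \in `]0, h[ -> is_derive s (1 : R) G (dG s).
  by move=> /subset_itv_oo_cc; apply: GdG.
have Gc : {within `[0, h], continuous G}.
  by apply: derivable_within_continuous => s /GdG [].
have [c ci] := MVT_segment (ltW h0) GdGo Gc.
rewrite /G scale0r !addr0 subr0 => ->.
pose K (t : R) : R := 'D_u f (a + c *: u + t *: v).
pose dK (t : R) : R := 'D_v ('D_u f) (a + c *: u + t *: v).
have KdK t : t \in `[0, h] -> is_derive t (1 : R) K (dK t).
  by move=> th; apply: is_derive_line; apply: dDf; rewrite addrAC; apply: inb.
have KdKo (s : R) : s \in `]0, h[ -> is_derive s (1 : R) K (dK s).
  by move=> /subset_itv_oo_cc; apply: KdK.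
have Kc : {within `[0, h], continuous K}.
  by apply: derivable_within_continuous => s /KdK [].
have [d di] := MVT_segment (ltW h0) KdKo Kc.
rewrite /K scale0r addr0 subr0 => E.
exists (a + c *: u + d *: v); first by rewrite addrAC; apply: inb.
by rewrite /dG (addrAC a) E expr2 -mulrA mulrC.
Qed.

(** The second difference is symmetric in [u] and [v], so the two mixed derivatives take a common
    value at two points [x] and [y] of a small ball; continuity brings both within [e / 2] of their
    values at [a]. *)
Lemma derive_swap U f a u v : open U -> U a -> Ck 2 U f ->
  'D_v ('D_u f) a = 'D_u ('D_v f) a.
Proof.
move=> oU Ua Cf; apply/eqP; rewrite -subr_eq0 -normr_eq0; apply/eqP/le_anti.
rewrite normr_ge0 andbT; apply/ler_addgt0Pr => /= e e0; rewrite add0r.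
have cont w z : {for a, continuous ('D_w ('D_z f))}.
  by have [_ /(_ z) [_ /(_ w)]] := Cf; apply.
have e2 : (0 : R) < e / 2 by rewrite divr_gt0.
have [n1 n2] := ((cvgrPdist_lt _ _).1 (cont v u) _ e2, (cvgrPdist_lt _ _).1 (cont u v) _ e2).
have nU : nbhs a U by apply: open_nbhs_nbhs.
pose A : set V := [set x | `|'D_v ('D_u f) a - 'D_v ('D_u f) x| < e / 2].
pose B : set V := [set x | `|'D_u ('D_v f) a - 'D_u ('D_v f) x| < e / 2].
have nUAB : nbhs a (U `&` (A `&` B)).
  apply: filterI; first exact: nU.
  by apply: filterI; [exact: n1|exact: n2].
have [r r0 br] : exists2 r : R, 0 < r & ball a r `<=` U `&` (A `&` B).
  have /nbhs_ballP [r r0 br] := nUAB.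
  exists r.
  exact: r0.
  exact: br.
have Cr : Ck 2 (ball a r) f.
  apply: Ck_subset Cf => x bx.
  exact: (br x bx).1.
have [h h0 hr] : exists2 h : R, 0 < h & h * (`|u| + `|v|) < r.
  have t0 : (0 : R) <= `|u| + `|v| by rewrite addr_ge0.
  (* The added 1 keeps the denominator positive when both vectors vanish; the factor 1/2 supplies
     the strict inequality. *)
  exists (r / (`|u| + `|v| + 1) / 2).
    by rewrite !divr_gt0 // ltr_wpDl.
  rewrite mulrAC ltr_pdivrMr // mulrAC.
  apply: (@le_lt_trans _ _ r); last by rewrite ltr_pMr // ltr1n.
  by rewrite ler_pdivrMr ?ltr_wpDl // ler_pM2l // lerDl.
have hr' : h * (`|v| + `|u|) < r by rewrite [_ + `|u|]addrC.
have [x bx Ex] := second_difference h0 hr Cr.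
have [y by_ Ey] := second_difference h0 hr' Cr.
have {Ex Ey} E : 'D_v ('D_u f) x = 'D_u ('D_v f) y.
  apply: (mulfI (x := h ^+ 2)); first by rewrite expf_neq0 // gt_eqF.
  rewrite -Ex -Ey (addrAC a).
  have sw (p q y1 y2 : R) : p - q - (y1 - y2) = p - y1 - (q - y2) by ring.
  exact: sw.
have [_ [dx _]] := br _ bx; have [_ [_ dy]] := br _ by_.
have tri (p q w : R) : `|p - w| < e / 2 -> `|q - w| < e / 2 -> `|p - q| <= e.
  move=> py qy; rewrite -(subrKA w) [e]splitr; apply: le_trans (ler_normD _ _) _.
  by apply: lerD; [exact: ltW|rewrite distrC ltW].
apply: tri dx _.
by rewrite E.
Qed.

End Schwarz.

(** * Smooth functions and maps on manifolds *)

Section Charts.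
Context {R : realType} {n : nat} {M : manifold R n}.
Implicit Types (p q x : M) (U : set M) (W : normedModType R).

Lemma mdom_open p : open (mdom p). Proof. exact: cdom_open. Qed.

Lemma mdom_self p : mdom p p. Proof. exact: chart_at_self. Qed.

Lemma nbhs_mdom p x : mdom p x -> nbhs x (mdom p).
Proof. by move=> dx; apply: open_nbhs_nbhs; split=> //; exact: mdom_open. Qed.

Lemma mchartK p x : mdom p x -> minv p (mchart p x) = x.
Proof. exact: cmapK. Qed.

Lemma near_minv p x (P : set M) : mdom p x -> nbhs x P ->
  \forall y \near mchart p x, P (minv p y).
Proof.
move=> dx nP.
have /(_ P) := @cinv_cont _ _ _ (chart_at p) (mchart p x) (ex_intro2 _ _ x dx erefl).
by apply; rewrite /= cmapK.
Qed.

Lemma near_chart p x : mdom p x ->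
  \forall y \near mchart p x, (mchart p @` mdom p) y.
Proof.
by move=> dx; apply: open_nbhs_nbhs; split; [exact: cmap_open|exists x].
Qed.

Lemma open_mchart_image p U : open U -> open (mchart p @` (U `&` mdom p)).
Proof.
move=> oU; rewrite openE => _ [x [Ux dx] <-].
have nU := near_minv dx (open_nbhs_nbhs (conj oU Ux)).
apply: filterS2 (near_chart dx) nU => _ [z dz <-].
by rewrite mchartK // => Uz; exists z.
Qed.

Lemma smooth_on_subset W U U' (h : M -> W) : U' `<=` U ->
  smooth_on U h -> smooth_on U' h.
Proof.
move=> sU hU p k; apply: Ck_subset (hU p k) => _ [x [Ux dx] <-].
by exists x => //; split=> //; apply: sU.
Qed.

Lemma smooth_on_cover W U (h : M -> W) :
  (forall x, U x -> exists2 U', U' x & smooth_on U' h) -> smooth_on U h.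
Proof.
move=> cov p k; apply: Ck_cover => _ [x [Ux dx] <-].
have [U' U'x hU'] := cov x Ux.
by exists (mchart p @` (U' `&` mdom p)); [exists x|exact: hU'].
Qed.

Lemma smooth_on_ext W U (h h' : M -> W) : open U ->
  (forall x, U x -> h x = h' x) -> smooth_on U h -> smooth_on U h'.
Proof.
move=> oU hh' hU p k; apply: Ck_ext (hU p k); first exact: open_mchart_image.
by move=> _ [x [Ux dx] <-] /=; rewrite mchartK // hh'.
Qed.

Lemma smooth_on_cst W U (w : W) : smooth_on U (fun=> w).
Proof. by move=> p k; apply: Ck_cst. Qed.

Lemma smooth_on_sum W U (I : Type) (r : seq I) (P : pred I) (h : I -> M -> W) :
  open U -> (forall i, smooth_on U (h i)) ->
  smooth_on U (fun x => \sum_(i <- r | P i) h i x).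
Proof.
move=> oU sh p k; apply: Ck_sum; first exact: open_mchart_image.
by move=> i; apply: sh.
Qed.

Lemma smooth_on_scale W U (k : M -> R^o) (h : M -> W) : open U ->
  smooth_on U k -> smooth_on U h -> smooth_on U (fun x => k x *: h x).
Proof.
move=> oU sk sh p m; apply: Ck_scale; first exact: open_mchart_image.
  exact: sk.
exact: sh.
Qed.

Lemma smooth_on_coord m U (h : M -> 'rV[R]_m) i : open U ->
  smooth_on U h -> smooth_on U (fun x => h x 0 i : R^o).
Proof.
by move=> oU sh p k; apply: Ck_coord; [exact: open_mchart_image|exact: sh].
Qed.

Lemma smooth_on_mchart q : smooth_on (mdom q) (mchart q).
Proof. by move=> p; rewrite setIC; exact: chart_at_smooth. Qed.

Lemma smooth_on_differentiable W U (h : M -> W) p x : open U -> U x -> mdom p x ->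
  smooth_on U h -> differentiable (h \o minv p) (mchart p x).
Proof. by move=> oU Ux dx /(_ p 1%N) [dh _]; apply: dh; exists x. Qed.

Definition mdifferentiable W (h : M -> W) p :=
  differentiable (h \o minv p) (mchart p p).

Lemma smooth_on_mdifferentiable W U (h : M -> W) x : open U -> U x ->
  smooth_on U h -> mdifferentiable h x.
Proof. by move=> oU Ux sh; apply: smooth_on_differentiable sh => //; apply: mdom_self. Qed.

(** Change of chart: near the point, [h \o minv p] is [h \o minv x] after the transition map from
    the chart around [p] to the one around [x], and [cfield p v x] is the differential of that
    transition map at [v]. *)
Lemma is_diff_chart W (h : M -> W) p x : mdom p x -> mdifferentiable h x ->
  is_diff (mchart p x) (h \o minv p) (fun v => mdiff h x (cfield p v x)).
Proof.
move=> dx dh.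
have dt : differentiable (mchart x \o minv p) (mchart p x).
  by apply: (smooth_on_differentiable (mdom_open x) (mdom_self x) dx); exact: smooth_on_mchart.
have := differentiableP dt => dt'.
have Ex : (mchart x \o minv p) (mchart p x) = mchart x x by rewrite /= mchartK.
have dh' : is_diff ((mchart x \o minv p) (mchart p x)) (h \o minv x) (mdiff h x).
  by rewrite Ex; exact: differentiableP dh.
have comp := is_diff_comp dt' dh'.
apply: near_eq_is_diff comp.
apply: filterS (near_minv dx (nbhs_mdom (mdom_self x))) => y dy /=.
by rewrite mchartK.
Qed.

Lemma near_mdom_chart p x : mdom p x ->
  \forall y \near mchart p x, mchart p (minv p y) = y.
Proof. by move=> dx; apply: filterS (near_chart dx) => _ [z dz <-]; rewrite mchartK. Qed.

Lemma mdifferentiable_mchart p x : mdom p x -> mdifferentiable (mchart p) x.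
Proof.
by move=> dx; apply: smooth_on_mdifferentiable (@smooth_on_mchart p) => //; exact: mdom_open.
Qed.

Lemma btriv_cfield p x v : mdom p x -> btriv (TM M) p x (cfield p v x) = v.
Proof.
move=> dx; have [_ E] := is_diff_chart dx (mdifferentiable_mchart dx).
rewrite /= -[LHS]/((fun v => mdiff (mchart p) x (cfield p v x)) v) -E.
have nid : \forall y \near mchart p x, id y = (mchart p \o minv p) y.
  by apply: filterS (near_mdom_chart dx) => y /= ->.
by have [_ ->] := near_eq_is_diff nid (is_diff_id (mchart p x)).
Qed.

(** The other composite is already known to be the identity, and for square matrices a one-sided
    inverse is two-sided. *)
Lemma cfield_btriv p x w : mdom p x -> cfield p (btriv (TM M) p x w) x = w.
Proof.
move=> dx.
have [L LE] : exists L : 'M_n, forall v, btriv (TM M) p x v = v *m L.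
  by exists (lin1_mx (btriv (TM M) p x)) => v; rewrite mul_rV_lin1.
have [K KE] : exists K : 'M_n, forall v, cfield p v x = v *m K.
  by exists (lin1_mx (bframe (TM M) p x)) => v; rewrite mul_rV_lin1.
have KL : K *m L = 1%:M.
  apply/row_matrixP => i; rewrite !rowE mulmx1 mulmxA -KE -LE.
  exact: btriv_cfield.
by rewrite KE LE -mulmxA (mulmx1C KL) mulmx1.
Qed.

Lemma cfield_self p v : cfield p v p = v.
Proof.
rewrite /cfield /=.
have nid : \forall y \near mchart p p, id y = (mchart p \o minv p) y.
  by apply: filterS (near_mdom_chart (mdom_self p)) => y /= ->.
by have [_ ->] := near_eq_is_diff nid (is_diff_id (mchart p p)).
Qed.

Lemma btriv_self p v : btriv (TM M) p p v = v.
Proof. by rewrite -[X in btriv _ _ _ X](cfield_self p) btriv_cfield //; exact: mdom_self. Qed.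

Lemma mdiffE W (h : M -> W) p dh :
  is_diff (mchart p p) (h \o minv p) dh -> mdiff h p = dh :> (_ -> _).
Proof. by case. Qed.

Lemma mdifferentiableP W (h : M -> W) p : mdifferentiable h p ->
  is_diff (mchart p p) (h \o minv p) (mdiff h p).
Proof. exact: differentiableP. Qed.

Lemma near_eq_mdiff W (h h' : M -> W) p : (\forall x \near p, h x = h' x) ->
  mdifferentiable h p -> is_diff (mchart p p) (h' \o minv p) (mdiff h p).
Proof.
move=> hh' dh; apply: near_eq_is_diff (mdifferentiableP dh).
exact: (near_minv (mdom_self p) hh').
Qed.

Lemma mdiff_scale W (k : M -> R^o) (h : M -> W) p v :
  mdifferentiable k p -> mdifferentiable h p ->
  mdiff (fun x => k x *: h x) p v = k p *: mdiff h p v + mdiff k p v *: h p.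
Proof.
move=> /mdifferentiableP dk /mdifferentiableP dh.
have := is_diff_scale dk dh => /= D; rewrite (mdiffE D) /=.
by rewrite !mchartK //; exact: mdom_self.
Qed.

Lemma mdiff_sum W (I : Type) (r : seq I) (P : pred I) (h : I -> M -> W) p v :
  (forall i, mdifferentiable (h i) p) ->
  mdiff (fun x => \sum_(i <- r | P i) h i x) p v =
  \sum_(i <- r | P i) mdiff (h i) p v.
Proof.
move=> dh; have D := is_diff_sum r P (fun i => mdifferentiableP (dh i)).
by rewrite (mdiffE D).
Qed.

Lemma mdiff_coord m (h : M -> 'rV[R]_m) p v i : mdifferentiable h p ->
  mdiff (fun x => h x 0 i : R^o) p v = mdiff h p v 0 i.
Proof. by move=> /mdifferentiableP dh; rewrite (mdiffE (is_diff_coord i dh)). Qed.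

End Charts.

(** * Smooth maps between manifolds and their differentials *)

Section Maps.
Context {R : realType} {m n : nat} {M : manifold R m} {N : manifold R n}.
Implicit Types (phi : M -> N) (p : M) (U : set N) (W : normedModType R).

(** Near each [x] the composite factors through the chart around [phi x]. The factorisation holds
    only on an open piece, hence the argument by covering. *)
Lemma smooth_on_comp phi W U (h : N -> W) : smooth_map phi -> open U ->
  smooth_on U h -> smooth_on (phi @^-1` U) (h \o phi).
Proof.
move=> [cphi sphi] oU sh p k; apply: Ck_cover => _ [x [Ux dx] <-].
pose q := phi x; pose A := phi @^-1` (U `&` mdom q).
have oA : open A by apply: open_comp => //; apply: openI => //; exact: mdom_open.
exists (mchart p @` (A `&` mdom p)).
  by exists x => //; split=> //; split=> //; exact: mdom_self.
have oA' : open (mchart p @` (A `&` mdom p)) by exact: open_mchart_image.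
apply: (@Ck_ext _ _ _ _ _ ((h \o minv q) \o ((mchart q \o phi) \o minv p))) => //.
  by move=> _ [z [[Uz dz] pz] <-] /=; rewrite !mchartK.
apply: (@Ck_comp _ _ _ _ _ _ (mchart q @` (U `&` mdom q))) => //.
- by move=> _ [z [[Uz dz] pz] <-] /=; exists (phi z) => //; rewrite mchartK.
- apply: Ck_subset (sphi q p k) => _ [z [[Uz dz] pz] <-].
  by exists z.
- exact: sh.
Qed.

Lemma mdifferentiable_map phi p : smooth_map phi ->
  mdifferentiable (mchart (phi p) \o phi) p.
Proof.
move=> [cphi sphi]; apply: smooth_on_mdifferentiable (sphi (phi p)).
  by apply: open_comp => //; exact: mdom_open.
exact: mdom_self.
Qed.

Lemma is_diff_map phi p W (h : N -> W) : smooth_map phi ->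
  mdifferentiable h (phi p) ->
  is_diff (mchart p p) ((h \o phi) \o minv p) (mdiff h (phi p) \o tmap phi p).
Proof.
move=> sphi dh; have dp := mdifferentiableP (mdifferentiable_map p sphi).
have E : ((mchart (phi p) \o phi) \o minv p) (mchart p p) = mchart (phi p) (phi p).
  by rewrite /= mchartK //; exact: mdom_self.
have dh' : is_diff (((mchart (phi p) \o phi) \o minv p) (mchart p p))
    (h \o minv (phi p)) (mdiff h (phi p)) by rewrite E; apply: mdifferentiableP.
apply: near_eq_is_diff (is_diff_comp dp dh').
have nd : nbhs p (phi @^-1` mdom (phi p)).
  by have [cphi _] := sphi; apply: cphi; apply: nbhs_mdom; exact: mdom_self.
apply: filterS (near_minv (mdom_self p) nd) => y dy /=.
by rewrite mchartK.
Qed.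

Lemma mdiff_comp phi p W (h : N -> W) u : smooth_map phi ->
  mdifferentiable h (phi p) ->
  mdiff (h \o phi) p u = mdiff h (phi p) (tmap phi p u).
Proof. by move=> sphi dh; rewrite (mdiffE (is_diff_map sphi dh)). Qed.

Lemma mdifferentiable_comp phi p W (h : N -> W) : smooth_map phi ->
  mdifferentiable h (phi p) -> mdifferentiable (h \o phi) p.
Proof. by move=> sphi dh; have [] := is_diff_map sphi dh. Qed.

End Maps.

Section MapComp.
Context {R : realType} {m n k : nat} {M : manifold R m} {N : manifold R n}
  {P : manifold R k}.

Lemma smooth_map_comp (phi : M -> N) (psi : N -> P) :
  smooth_map phi -> smooth_map psi -> smooth_map (psi \o phi).
Proof.
move=> sphi spsi; have [cphi _] := sphi; have [cpsi hpsi] := spsi.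
split; first by move=> x; apply: continuous_comp; [exact: cphi|exact: cpsi].
move=> q; rewrite comp_preimage.
apply: (@smooth_on_comp _ _ _ _ _ phi _ (psi @^-1` mdom q) (mchart q \o psi)) => //.
by apply: open_comp => //; exact: mdom_open.
Qed.

Lemma tmap_comp (phi : M -> N) (psi : N -> P) p u :
  smooth_map phi -> smooth_map psi ->
  tmap (psi \o phi) p u = tmap psi (phi p) (tmap phi p u).
Proof.
move=> sphi spsi; apply: (@mdiff_comp _ _ _ _ _ phi p _ (mchart (psi (phi p)) \o psi)) => //.
exact: mdifferentiable_map.
Qed.

End MapComp.

Section MapId.
Context {R : realType} {n : nat} {M : manifold R n}.

Lemma smooth_map_id : smooth_map (id : M -> M).
Proof.
by split; [move=> x; exact: cvg_id|move=> q; exact: smooth_on_mchart].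
Qed.

Lemma tmap_id (p : M) u : tmap (id : M -> M) p u = u.
Proof. exact: btriv_self. Qed.

End MapId.

(** * Connections *)

Section Sections.
Context {R : realType} {n : nat} {M : manifold R n} {B : vector_bundle M}.
Implicit Types (U : set M) (p q x : M) (xi eta : forall x, B x).

Lemma frame_sum i x (z : B x) : bdom B i x ->
  z = \sum_a btriv B i x z 0 a *: bframe B i x 'e_a.
Proof.
move=> dx; rewrite -[LHS](btrivK dx) {1}(row_sum_delta (btriv B i x z)) linear_sum.
by apply: eq_bigr => a _; rewrite linearZ.
Qed.

Lemma smooth_frame i w : smooth_section (bdom B i) (fun x => bframe B i x w).
Proof. by move=> j; exact: btrans_smooth. Qed.

Lemma smooth_section_subset U U' xi : U' `<=` U ->
  smooth_section U xi -> smooth_section U' xi.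
Proof. by move=> sU sxi i; apply: smooth_on_subset (sxi i) => x [/sU]. Qed.

Lemma smooth_section_ext U xi eta : open U -> (forall x, U x -> xi x = eta x) ->
  smooth_section U xi -> smooth_section U eta.
Proof.
move=> oU E sxi i; apply: smooth_on_ext (sxi i).
  by apply: openI => //; exact: bdom_open.
by move=> x [Ux _]; rewrite E.
Qed.

Lemma smooth_section_scale U (h : M -> R^o) xi : open U -> smooth_on U h ->
  smooth_section U xi -> smooth_section U (fun x => h x *: xi x).
Proof.
move=> oU sh sxi i; have oUi : open (U `&` bdom B i).
  by apply: openI => //; exact: bdom_open.
apply: (@smooth_on_ext _ _ _ _ _ (fun x => h x *: btriv B i x (xi x))) => //.
  by move=> x _; rewrite linearZ.
apply: (smooth_on_scale oUi _ (sxi i)).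
by apply: smooth_on_subset sh => x [].
Qed.

Lemma smooth_section_sum U k (xi : 'I_k -> forall x, B x) : open U ->
  (forall a, smooth_section U (xi a)) -> smooth_section U (fun x => \sum_a xi a x).
Proof.
move=> oU sxi i; have oUi : open (U `&` bdom B i).
  by apply: openI => //; exact: bdom_open.
apply: (@smooth_on_ext _ _ _ _ _ (fun x => \sum_a btriv B i x (xi a x))) => //.
  by move=> x _; rewrite linear_sum.
by apply: smooth_on_sum => // a; exact: sxi.
Qed.

Lemma smooth_section0 U : smooth_section U (fun x => 0 : B x).
Proof.
move=> i; rewrite (_ : (fun x => btriv B i x 0) = fun=> 0); first exact: smooth_on_cst.
by apply/funext => x; rewrite linear0.
Qed.

Lemma smooth_section_coord U xi i a : open U -> U `<=` bdom B i ->
  smooth_section U xi -> smooth_on U (fun x => btriv B i x (xi x) 0 a : R^o).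
Proof.
move=> oU Ui sxi; apply: (smooth_on_coord a (h := fun x => btriv B i x (xi x))) => //.
by apply: smooth_on_subset (sxi i) => x Ux; split=> //; exact: Ui.
Qed.

(** One trivialisation is enough: it makes the section a combination of a local frame with smooth
    coefficients, and frames are smooth in every trivialisation. *)
Lemma smooth_section_frame U i xi : open U -> U `<=` bdom B i ->
  smooth_on U (fun x => btriv B i x (xi x)) -> smooth_section U xi.
Proof.
move=> oU Ui sxi.
apply: (@smooth_section_ext _
  (fun x => \sum_a btriv B i x (xi x) 0 a *: bframe B i x 'e_a)) => //.
  by move=> x /Ui dx; rewrite -frame_sum.
apply: smooth_section_sum => // a; apply: smooth_section_scale => //.
  exact: (smooth_on_coord a (h := fun x => btriv B i x (xi x))).
exact: smooth_section_subset Ui (smooth_frame i 'e_a).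
Qed.

Lemma mdifferentiable_section U xi i x : open U -> U x -> bdom B i x ->
  smooth_section U xi -> mdifferentiable (fun y => btriv B i y (xi y)) x.
Proof.
move=> oU Ux dx sxi; apply: smooth_on_mdifferentiable (sxi i); last by [].
by apply: openI => //; exact: bdom_open.
Qed.

End Sections.

Section Connections.
Context {R : realType} {n : nat} {M : manifold R n} {B : vector_bundle M}.
Context (D : connection B).
Implicit Types (U : set M) (p q x : M) (v : 'rV[R]_n) (xi eta : forall x, B x).

(** A cut-off that replaces a bump function. It is smooth on [U], being constant there, and the
    Leibniz rule on [U] ignores its jump at the boundary. *)
Let indic U : M -> R^o := fun x => if `[< U x >] then 1 else 0.

Let cov_indic U p v xi : open U -> U p -> smooth_section U xi ->
  D p v (fun x => indic U x *: xi x) = D p v xi.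
Proof.
move=> oU Up sxi; have E x : U x -> (1 : R^o) = indic U x.
  by rewrite /indic => Ux; rewrite asboolT.
have si : smooth_on U (indic U) by apply: smooth_on_ext (smooth_on_cst U (1 : R^o)).
rewrite (cov_leibniz D v oU Up si sxi) -(E _ Up) scale1r.
have n1 : \forall x \near p, cst (1 : R^o) x = indic U x.
  by apply: filterS (open_nbhs_nbhs (conj oU Up)) => x /E.
have d1 : mdifferentiable (cst (1 : R^o)) p by apply: differentiable_cst.
rewrite (mdiffE (near_eq_mdiff n1 d1)).
rewrite [mdiff _ p v](_ : _ = 0) ?scale0r ?add0r //.
by rewrite /mdiff (_ : cst (1 : R^o) \o minv p = cst 1) // diff_cst.
Qed.

(* Connections are local: by the Leibniz rule, multiplying by the indicator
   function of a neighbourhood of [p] does not affect the derivative at [p]. *)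
Lemma cov_local U p v xi eta : open U -> U p -> smooth_section U xi ->
  (forall x, U x -> xi x = eta x) -> D p v xi = D p v eta.
Proof.
move=> oU Up sxi E; have seta := smooth_section_ext oU E sxi.
rewrite -(cov_indic v oU Up sxi) -(cov_indic v oU Up seta); congr (D p v _).
apply: functional_extensionality_dep => x; rewrite /indic.
by case: asboolP => [/E ->|_]; rewrite ?scale0r.
Qed.

Lemma cov0 p v : D p v (fun x => 0 : B x) = 0.
Proof.
have := cov_leibniz D v openT (I : setT p) (smooth_on_cst setT (0 : R^o)) (smooth_section0 setT).
rewrite scaler0 scale0r addr0 => <-; congr (D p v _).
by apply: functional_extensionality_dep => x; rewrite scale0r.
Qed.

Lemma cov_sum U p v k (xi : 'I_k -> forall x, B x) : open U -> U p ->
  (forall a, smooth_section U (xi a)) ->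
  D p v (fun x => \sum_a xi a x) = \sum_a D p v (xi a).
Proof.
move=> oU Up; elim: k xi => [|k ih] xi sxi.
  rewrite big_ord0 -[RHS](cov0 p v); congr (D p v _).
  by apply: functional_extensionality_dep => x; rewrite big_ord0.
rewrite big_ord_recl -ih => [|a]; last exact: sxi.
rewrite -(covD D v oU Up) //; last by apply: smooth_section_sum.
congr (D p v _).
by apply: functional_extensionality_dep => x; rewrite big_ord_recl.
Qed.

Lemma cov_lincomb U p v k (c : 'I_k -> M -> R^o) (xi : 'I_k -> forall x, B x) :
  open U -> U p -> (forall a, smooth_on U (c a)) ->
  (forall a, smooth_section U (xi a)) ->
  D p v (fun x => \sum_a c a x *: xi a x) =
  \sum_a (mdiff (c a) p v *: xi a p + c a p *: D p v (xi a)).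
Proof.
move=> oU Up sc sxi; rewrite (cov_sum (U := U)) //; last first.
  by move=> a; apply: smooth_section_scale.
by apply: eq_bigr => a _; rewrite (cov_leibniz D v oU Up).
Qed.

Lemma cov_frame U i p v xi : open U -> U p -> bdom B i p -> smooth_section U xi ->
  D p v xi =
  \sum_a (mdiff (fun x => btriv B i x (xi x)) p v 0 a *: bframe B i p 'e_a
          + btriv B i p (xi p) 0 a *: D p v (fun x => bframe B i x 'e_a)).
Proof.
move=> oU Up ip sxi; have oUi : open (U `&` bdom B i).
  by apply: openI => //; exact: bdom_open.
have sxi' : smooth_section (U `&` bdom B i) xi by apply: smooth_section_subset sxi => x [].
rewrite (cov_local (U := U `&` bdom B i) (eta :=
  fun x => \sum_a btriv B i x (xi x) 0 a *: bframe B i x 'e_a) v oUi) //; last first.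
  by move=> x [_ ix]; exact: frame_sum.
rewrite (cov_lincomb (U := U `&` bdom B i)) //; last 2 first.
- by move=> a; apply: smooth_section_coord => // x [].
- by move=> a; apply: smooth_section_subset (smooth_frame i 'e_a) => x [].
apply: eq_bigr => a _; congr (_ *: _ + _).
by rewrite (mdiff_coord (h := fun x => btriv B i x (xi x))) //;
   apply: mdifferentiable_section sxi.
Qed.

End Connections.

(** * Pulled-back connections *)

Section PullbackConnection.
Context {R : realType} {m n : nat} {M : manifold R m} {N : manifold R n}.
Context {B : vector_bundle N} (D : connection B).

(** Independence of the frame: the definition fixes the frame around [phi p], whereas any local
    expansion in smooth sections of [B] gives the same value. It is needed for frames pushed forward
    by an automorphism. *)
Lemma pullback_cov_lincomb (phi : M -> N) U p v k (c : 'I_k -> M -> R^o)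
    (e : 'I_k -> forall y, B y) (s : forall x, B (phi x)) :
  smooth_map phi -> open U -> U (phi p) ->
  (forall a, mdifferentiable (c a) p) -> (forall a, smooth_section U (e a)) ->
  (\forall x \near p, s x = \sum_a c a x *: e a (phi x)) ->
  pullback_cov D phi p v s =
  \sum_a (mdiff (c a) p v *: e a (phi p) + c a p *: D (phi p) (tmap phi p v) (e a)).
Proof.
move=> sphi oU Up dc se sE; rewrite /pullback_cov.
set i := phi p; have ip : bdom B i i by exact: bdom_self.
pose E a y := btriv B i y (e a y).
have dE a : mdifferentiable (E a) i by apply: mdifferentiable_section (se a).
pose t a x := c a x *: (E a \o phi) x.
have dEphi a : mdifferentiable (E a \o phi) p by apply: mdifferentiable_comp.
have dt a : mdifferentiable (t a) p.
  by have [] := is_diff_scale (mdifferentiableP (dc a)) (mdifferentiableP (dEphi a)).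
have dS : mdifferentiable (fun x => \sum_a t a x) p.
  by have [] := is_diff_sum (index_enum 'I_k) predT (fun a => mdifferentiableP (dt a)).
have nE : \forall x \near p, \sum_a t a x = btriv B i (phi x) (s x).
  apply: filterS sE => x ->; rewrite linear_sum; apply: eq_bigr => a _.
  by rewrite linearZ.
rewrite (mdiffE (near_eq_mdiff nE dS)) mdiff_sum //.
rewrite -(nbhs_singleton nE).
under [RHS]eq_bigr => a _ do rewrite [e a _](frame_sum _ ip) (cov_frame D _ oU Up ip (se a)).
(* Both sides are now expanded in the frame around [phi p]. With [E a] the components of [e a], the
   frame vectors get the coefficients dc E + c dE and their covariant derivatives the coefficients c
   E. *)
transitivity (\sum_b \sum_a (mdiff (t a) p v 0 b *: bframe B i i 'e_b
    + t a p 0 b *: D i (tmap phi p v) (fun y => bframe B i y 'e_b))).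
  apply: eq_bigr => b _; rewrite big_split /= -!scaler_suml.
  by rewrite -2!summxE.
rewrite exchange_big /=; apply: eq_bigr => a _.
rewrite !scaler_sumr -big_split /=; apply: eq_bigr => b _.
rewrite mdiff_scale // mdiff_comp // !mxE /= scalerDl scalerDr !scalerA.
by rewrite [RHS]addrCA addrA.
Qed.

End PullbackConnection.

(** * Bundle automorphisms *)

Section BundleMaps.
Context {R : realType} {n : nat} {N : manifold R n} {S : vector_bundle N}.

(** In local frames [F] acts by smooth matrix entries on smooth coefficients. The statement is for
    sections along a map, so as to serve both sections of [S] (with [phi] the identity) and
    two-forms along [phi]. *)
Lemma smooth_along_bundle_map m (M : manifold R m) (phi : M -> N)
    (F : bundle_map S) (U : set M) (s : forall x, S (phi x)) :
  smooth_map phi -> open U ->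
  (forall i, smooth_on (U `&` phi @^-1` bdom S i) (fun x => btriv S i (phi x) (s x))) ->
  forall j, smooth_on (U `&` (bmbase F \o phi) @^-1` bdom S j)
    (fun x => btriv S j (bmbase F (phi x)) (F (phi x) (s x))).
Proof.
move=> sphi oU ss j; apply: smooth_on_cover => x0 [Ux0 jx0].
pose i := phi x0; pose A := bdom S i `&` bmbase F @^-1` bdom S j.
have [cphi _] := sphi; have [cF _] := bmbase_smooth F.
have oA : open A.
  by apply: openI; [exact: bdom_open|apply: open_comp => //; exact: bdom_open].
have oUA : open (U `&` phi @^-1` A) by apply: openI => //; apply: open_comp.
have sc : smooth_on (U `&` phi @^-1` A) (fun x => btriv S i (phi x) (s x)).
  by apply: smooth_on_subset (ss i) => x [Ux []].
exists (U `&` phi @^-1` A); first by split=> //; split=> //; exact: bdom_self.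
pose T (a : 'I_(brank S)) y := btriv S j (bmbase F y) (F y (bframe S i y 'e_a)).
apply: (@smooth_on_ext _ _ _ _ _
  (fun x => \sum_a btriv S i (phi x) (s x) 0 a *: (T a \o phi) x)) => //.
  move=> x [_ [ix _]]; rewrite [in RHS](frame_sum (s x) ix) !linear_sum.
  by apply: eq_bigr => a _; rewrite !linearZ.
apply: smooth_on_sum => // a; apply: (smooth_on_scale oUA).
  exact: (smooth_on_coord a oUA sc).
have sT := smooth_on_comp sphi oA (bmfib_smooth F i j 'e_a).
by apply: smooth_on_subset sT => x [].
Qed.

(** Proofs of equality between points are unique, so an equality in the total space restricts to the
    fiber. This is how the cancellation laws of [total_map] become fiberwise statements. *)
Lemma existT_inj (P : N -> Type) q (y z : P q) : existT P q y = existT P q z -> y = z.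
Proof.
move=> E; have := projT2_eq E.
by rewrite (eq_irrelevance (projT1_eq E) erefl).
Qed.

Lemma btriv_ecast j x y (e : x = y) (z : S x) :
  btriv S j y (ecast q (S q) e z) = btriv S j x z.
Proof. by case: _ / e. Qed.

Definition inv_aut (f : unbased_aut S) : unbased_aut S :=
  UnbasedAut (ubinvK f) (ubmapK f).

Variable f : unbased_aut S.

Lemma bmbaseK q : bmbase (ubinv f) (bmbase f q) = q.
Proof. exact: (bmbase_invK (inv_aut f)). Qed.

Lemma unbased_aut_inj q : injective (f q).
Proof.
move=> x y E; apply: (@existT_inj (fun q => S q)); apply: (can_inj (ubmapK f)).
by rewrite /total_map /= E.
Qed.

(** At a point [f_0 q] the transport can be turned into one along a loop at a single point, which is
    trivial. *)
Lemma push_sectionE (xi : forall q, S q) q :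
  push_section f xi (bmbase f q) = f q (xi q).
Proof.
rewrite /push_section; move: (bmbase_invK f (bmbase f q)).
by rewrite bmbaseK => e; rewrite (eq_irrelevance e erefl).
Qed.

(** Lets any pointwise identity be checked at points [f_0 q] only, where transports vanish. *)
Lemma bmbase_surj (P : N -> Prop) : (forall q, P (bmbase f q)) -> forall q, P q.
Proof. by move=> Pf q; rewrite -(bmbase_invK f q); exact: Pf. Qed.

(** In a trivialisation, the pushed section is the smooth map [q |-> f q (xi q)] read in that
    trivialisation and then composed with [f_0^-1]. *)
Lemma smooth_section_push (U : set N) (xi : forall q, S q) : open U ->
  smooth_section U xi -> smooth_section (bmbase (ubinv f) @^-1` U) (push_section f xi).
Proof.
move=> oU sxi j.
have sj := smooth_along_bundle_map f smooth_map_id oU sxi j.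
have [cf _] := bmbase_smooth f; have [cfi _] := bmbase_smooth (ubinv f).
have oUj : open (U `&` (bmbase f \o id) @^-1` bdom S j).
  by apply: openI => //; apply: open_comp => //; exact: bdom_open.
have := smooth_on_comp (bmbase_smooth (ubinv f)) oUj sj.
rewrite (_ : _ @^-1` _ = bmbase (ubinv f) @^-1` U `&` bdom S j); last first.
  by apply/seteqP; split=> x /= [Ux]; rewrite /preimage /= bmbase_invK.
apply: smooth_on_ext.
  by apply: openI; [exact: open_comp|exact: bdom_open].
by move=> x _; rewrite /push_section btriv_ecast.
Qed.

End BundleMaps.

Section PushInverse.
Context {R : realType} {n : nat} {N : manifold R n} {S : vector_bundle N}.
Variable f : unbased_aut S.

Lemma push_section_inv (xi : forall q, S q) :
  push_section f (push_section (inv_aut f) xi) = xi.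
Proof.
apply: functional_extensionality_dep.
apply: (bmbase_surj (f := f)) => q; rewrite push_sectionE.
apply: (@existT_inj _ _ N (fun q => S q)); rewrite -[RHS](ubinvK f).
(* Both end points of the transport are made variables, so that the equality between them can be
   eliminated. *)
have key p' p (e : p' = p) (z : S p') :
    existT (fun q => S q) (bmbase f p) (f p (ecast x (S x) e z)) =
    total_map f (existT _ p' z) by case: _ / e.
exact: key.
Qed.

End PushInverse.

(** * Parallel automorphisms: pulled-back connection and fundamental form *)

Section Dualities.
Context {R : realType} {n : nat} {Sigma : scalar_structure R n}
  {Delta : duality_structure Sigma}.
Implicit Types (f : unbased_aut Delta) (J : endo_field Delta).

(** The transport joins base points of two elements of the total space, [f^-1 (f x)] and [x].
    Abstracting both elements lets their equality be eliminated at once, base and fiber together. *)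
Lemma AdE f J q x : Ad f J (f q x) = f q (J q x).
Proof.
have key (z1 z2 : {q & Delta q}) (e : bmbase f (projT1 z1) = bmbase f (projT1 z2)) :
    z1 = z2 -> ecast y (Delta y) e (f _ (J _ (projT2 z1))) = f _ (J _ (projT2 z2)).
  by move=> E; case: _ / E in e *; rewrite (eq_irrelevance e erefl).
exact: (key (total_map (ubinv f) (total_map f (existT _ q x))) (existT _ q x) _ (ubmapK f _)).
Qed.

(** The frame around [phi p] is pushed forward by [f]. In the pushed frame the image of [s] has the
    same coefficients as [s], and covariant constancy gives the derivatives of the frame itself. *)
Lemma pullback_cov_push f m (M : manifold R m) (phi : M -> Sigma) p v
    (s : forall x, Delta (phi x)) :
  covariantly_constant f -> smooth_map phi ->
  mdifferentiable (fun x => btriv Delta (phi p) (phi x) (s x)) p ->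
  pullback_cov (dconn Delta) (bmbase f \o phi) p v (fun x => f (phi x) (s x)) =
  f (phi p) (pullback_cov (dconn Delta) phi p v s).
Proof.
move=> cf sphi ds; have sf := bmbase_smooth f.
pose i := phi p; pose e a y := bframe Delta i y ('e_a : 'rV_(brank Delta)).
pose U := bmbase (ubinv f) @^-1` bdom Delta i.
have se a : smooth_section (bdom Delta i) (e a) by exact: smooth_frame.
have oi := bdom_open Delta i; have ii : bdom Delta i i by exact: bdom_self.
have [cphi _] := sphi; have [cfi _] := bmbase_smooth (ubinv f).
rewrite (@pullback_cov_lincomb _ _ _ _ _ _ _ _ U _ _ _
   (fun a x => btriv Delta i (phi x) (s x) 0 a)
   (fun a => push_section f (e a))); first last.
- have nd : nbhs p (phi @^-1` bdom Delta i) by apply: cphi; apply: open_nbhs_nbhs.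
  apply: filterS nd => x ix /=; rewrite {1}(frame_sum (s x) ix) linear_sum.
  by apply: eq_bigr => a _; rewrite linearZ push_sectionE.
- by move=> a; apply: smooth_section_push.
- by move=> a; have [] := is_diff_coord a (mdifferentiableP ds).
- by rewrite /U /preimage /= bmbaseK.
- exact: open_comp.
- exact: smooth_map_comp.
rewrite /pullback_cov linear_sum; apply: eq_bigr => a _.
rewrite [RHS]linearD ![in RHS]linearZ; congr (_ + _); congr (_ *: _).
- exact: (mdiff_coord (h := fun x => btriv Delta i (phi x) (s x))).
- exact: push_sectionE.
- have tc : tmap (bmbase f \o phi) p v = tmap (bmbase f) (phi p) (tmap phi p v).
    exact: tmap_comp.
  have E := cf (bdom Delta i) (e a) (phi p) (tmap phi p v) oi ii (se a).
  exact: (etrans (congr1 (fun w => dconn Delta (bmbase f (phi p)) w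
    (push_section f (e a))) tc) E).
Qed.

Section Theta.
Variables (J : endo_field Delta) (hJ : taming J).
Arguments J : clear implicits.

Lemma taming_lincomb q k (c : 'I_k -> R) (z : 'I_k -> Delta q) :
  J q (\sum_a c a *: z a) = \sum_a c a *: J q (z a).
Proof.
have linJ : linear (J q) by exact: taming_linear.
pose JM := GRing.isLinear.Build _ _ _ _ _ linJ.
pose JL : {linear Delta q -> Delta q} := HB.pack (J q) JM.
rewrite -[J q]/(JL : _ -> _) linear_sum.
by apply: eq_bigr => a _; rewrite linearZ.
Qed.

Let smooth_frameJ i w : smooth_section (bdom Delta i) (fun y => J y (bframe Delta i y w)).
Proof.
apply: (smooth_section_frame (i := i)) => //; first exact: bdom_open.
exact: (taming_smooth hJ).
Qed.

Lemma smooth_section_taming U (xi : forall y, Delta y) : open U -> smooth_section U xi ->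
  smooth_section U (fun y => J y (xi y)).
Proof.
move=> oU sxi i; apply: smooth_on_cover => x [Ux ix].
have oUi : open (U `&` bdom Delta i) by apply: openI => //; exact: bdom_open.
exists (U `&` bdom Delta i) => //.
have sJ : smooth_section (U `&` bdom Delta i)
    (fun y => \sum_a btriv Delta i y (xi y) 0 a *: J y (bframe Delta i y 'e_a)).
  apply: smooth_section_sum => // a; apply: smooth_section_scale => //.
    apply: smooth_section_coord => //.
    by apply: smooth_section_subset sxi => y [].
  by apply: smooth_section_subset (@smooth_frameJ i 'e_a) => y [].
have := sJ i; rewrite -setIA setIid; apply: smooth_on_ext => // y [_ iy].
by rewrite [in RHS](frame_sum (xi y) iy) taming_lincomb.
Qed.

(** Tensoriality: expanding [xi] in a frame, the terms with derivatives of the coefficients occur in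
    both summands and cancel because [J] is linear. Only the value at [q] survives, and the section
    used in [Theta] has that same value. *)
Lemma ThetaE U q v xi : open U -> U q -> smooth_section U xi ->
  Theta J v (xi q) = dconn Delta q v (fun y => J y (xi y)) - J q (dconn Delta q v xi).
Proof.
pose e a y := bframe Delta q y ('e_a : 'rV_(brank Delta)).
have tens W eta : open W -> W q -> smooth_section W eta ->
    dconn Delta q v (fun y => J y (eta y)) - J q (dconn Delta q v eta) =
    \sum_a btriv Delta q q (eta q) 0 a *:
      (dconn Delta q v (fun y => J y (e a y)) - J q (dconn Delta q v (e a))).
  move=> oW Wq seta; have qq : bdom Delta q q by exact: bdom_self.
  have oWq : open (W `&` bdom Delta q) by apply: openI => //; exact: bdom_open.
  have seta' : smooth_section (W `&` bdom Delta q) eta.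
    by apply: smooth_section_subset seta => x [].
  pose c a x : R^o := btriv Delta q x (eta x) 0 a.
  have sc a : smooth_on (W `&` bdom Delta q) (c a).
    by apply: smooth_section_coord => // x [].
  have se a : smooth_section (W `&` bdom Delta q) (e a).
    by apply: smooth_section_subset (smooth_frame q 'e_a) => x [].
  have seJ a : smooth_section (W `&` bdom Delta q) (fun y => J y (e a y)).
    exact: smooth_section_taming.
  rewrite (cov_local (dconn Delta) (U := W `&` bdom Delta q) (xi := fun y => J y (eta y))
    (eta := fun y => \sum_a c a y *: J y (e a y)) v oWq) //; last first.
  - by move=> y [_ qy]; rewrite {1}(frame_sum (eta y) qy) taming_lincomb.
  - exact: smooth_section_taming.
  rewrite (cov_local (dconn Delta) (U := W `&` bdom Delta q) (xi := eta)
    (eta := fun y => \sum_a c a y *: e a y) v oWq) //; last first.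
    by move=> y [_ qy]; exact: frame_sum.
  rewrite !(cov_lincomb (dconn Delta) (U := W `&` bdom Delta q)) //.
  rewrite !big_split /= -[X in X - _]addrC.
  have -> : J q (\sum_i mdiff (c i) q v *: e i q + \sum_i c i q *: dconn Delta q v (e i))
     = \sum_i mdiff (c i) q v *: J q (e i q) + \sum_i c i q *: J q (dconn Delta q v (e i)).
    rewrite -[X in J q (X + _)]scale1r (taming_linear hJ) scale1r.
    by rewrite !taming_lincomb.
  rewrite [X in X - _]addrC opprD addrACA subrr add0r -sumrB.
  by apply: eq_bigr => a _; rewrite scalerBr.
move=> oU Uq sxi; rewrite (tens U xi) // /Theta.
have qq : bdom Delta q q by exact: bdom_self.
rewrite (tens (bdom Delta q) (fun y => bframe Delta q y (btriv Delta q q (xi q)))) //.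
- by rewrite btrivK.
- exact: bdom_open.
- exact: smooth_frame.
Qed.

Lemma Theta_linear q (x : Delta q) : linear (fun v => Theta J v x).
Proof.
move=> a u v; rewrite /Theta.
have qq : bdom Delta q q by exact: bdom_self.
have oq := bdom_open Delta q.
have sx : smooth_section (bdom Delta q) (fun y => bframe Delta q y (btriv Delta q q x)).
  exact: smooth_frame.
have sJx := smooth_section_taming oq sx.
rewrite (cov_linear (dconn Delta) oq qq sx) (cov_linear (dconn Delta) oq qq sJx) (taming_linear hJ).
by rewrite scalerBr opprD addrACA.
Qed.

(** The section [xi] that defines the left side at [f_0 q] is pulled back to [eta] by the inverse of
    [f]. Both [xi] and its image under [Ad f J] are then pushed sections, so covariant constancy
    applies to each, and [ThetaE] accepts [eta]. *)
Lemma Theta_push f q v (x : Delta q) : covariantly_constant f ->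
  Theta (Ad f J) (tmap (bmbase f) q v) (f q x) = f q (Theta J v x).
Proof.
move=> cf; rewrite {1}/Theta.
set p := bmbase f q.
set xi := fun y => bframe Delta p y (btriv Delta p p (f q x)).
pose eta := push_section (inv_aut f) xi.
pose U := bmbase f @^-1` bdom Delta p.
have oU : open U by have [c _] := bmbase_smooth f; apply: open_comp => //; exact: bdom_open.
have Uq : U q by exact: bdom_self.
have seta : smooth_section U eta.
  by apply: (smooth_section_push (inv_aut f)); [exact: bdom_open|exact: smooth_frame].
have pe : push_section f eta = xi by exact: push_section_inv.
have ex : eta q = x.
  apply: (unbased_aut_inj (f := f)); rewrite -push_sectionE pe /xi btrivK //.
have pJ : (fun y => Ad f J (xi y)) = push_section f (fun y => J y (eta y)).
  apply: functional_extensionality_dep; apply: (bmbase_surj (f := f)) => y.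
  by rewrite -pe !push_sectionE AdE.
rewrite pJ -pe (cf U) //; last exact: smooth_section_taming.
by rewrite (cf U) // AdE -linearB -(ThetaE v oU Uq seta) ex.
Qed.

End Theta.

End Dualities.

(** * Second derivatives of composites and coordinate representations *)

Section SecondDerivatives.
Context {R : realType}.

Lemma is_derive_diff (V W : normedModType R) (f : V -> W) x df v :
  is_diff x f df -> 'D_v f x = df v.
Proof. by move=> [dfx <-]; rewrite deriveE. Qed.

Lemma derive_diff2 (V W : normedModType R) U (f : V -> W) a v : open U -> U a ->
  Ck 2 U f -> is_diff a ('D_v f) (fun u => 'D_u ('D_v f) a).
Proof.
move=> oU Ua [_ /(_ v) [dDf _]].
apply: is_diff_eq (differentiableP (dDf a Ua)) _.
by apply/funext => u; rewrite deriveE //; exact: dDf.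
Qed.

Lemma derive_row_coord (V : normedModType R) n (f : V -> 'rV[R]_n) x v i :
  differentiable f x -> ('D_v f x) 0 i = 'D_v (fun y => f y 0 i : R^o) x.
Proof.
move=> df; have := is_diff_coord i (differentiableP df) => /is_derive_diff ->.
by rewrite deriveE.
Qed.

Lemma derive_swap_row (V : normedModType R) n U (f : V -> 'rV[R]_n) a u v :
  open U -> U a -> Ck 2 U f -> 'D_v ('D_u f) a = 'D_u ('D_v f) a.
Proof.
move=> oU Ua Cf; have [df Df] := Cf; apply/rowP => i.
have E w z : ('D_w ('D_z f) a) 0 i = 'D_w ('D_z (fun y => f y 0 i : R^o)) a.
  rewrite derive_row_coord; last by have [dDf _] := Df z; exact: dDf.
  apply: near_eq_derive; apply: filterS (open_nbhs_nbhs (conj oU Ua)) => x Ux.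
  by rewrite derive_row_coord //; exact: df.
have Ci : Ck 2 U (fun y => f y 0 i : R^o) := Ck_coord i oU Cf.
exact: (etrans (E v u) (etrans (derive_swap u v oU Ua Ci) (esym (E u v)))).
Qed.

(** After one differentiation the direction ['D_v F x] in which [P] is derived varies with [x];
    expanding it in the standard basis separates the moving direction from the moving point, and the
    product rule yields the two terms. *)
Lemma derive2_comp m n k (U : set 'rV[R]_m) (U' : set 'rV[R]_n)
    (F : 'rV[R]_m -> 'rV[R]_n) (P : 'rV[R]_n -> 'rV[R]_k) a u v :
  open U -> open U' -> U a -> U `<=` F @^-1` U' -> Ck 2 U F -> Ck 2 U' P ->
  'D_u ('D_v (P \o F)) a =
  'd P (F a) ('D_u ('D_v F) a) + 'D_('d F a u) ('D_('d F a v) P) (F a).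
Proof.
move=> oU oU' Ua sU CF CP; have [dF DF] := CF; have [dP DP] := CP.
have nU := open_nbhs_nbhs (conj oU Ua).
have U'b : U' (F a) by exact: sU.
have nU' := open_nbhs_nbhs (conj oU' U'b).
have dPe z x : U' x -> 'D_z P x = \sum_i z 0 i *: 'D_('e_i) P x.
  move=> U'x; rewrite deriveE; last exact: dP.
  rewrite {1}(row_sum_delta z) linear_sum; apply: eq_bigr => i _.
  by rewrite linearZ deriveE //; exact: dP.
have E1 : \forall x \near a, \sum_i 'D_v F x 0 i *: ('D_('e_i) P \o F) x = 'D_v (P \o F) x.
  apply: filterS nU => x Ux.
  have := is_diff_comp (differentiableP (dF x Ux)) (differentiableP (dP _ (sU _ Ux))).
  move=> /is_derive_diff ->; rewrite /= -(deriveE _ (dF x Ux)).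
  by rewrite -deriveE; [rewrite dPe //; exact: sU|exact: dP (sU _ Ux)].
have dDP i : is_diff (F a) ('D_('e_i) P) (fun w => 'D_w ('D_('e_i) P) (F a)).
  exact: (derive_diff2 _ oU').
have dDPF i := is_diff_comp (differentiableP (dF a Ua)) (dDP i).
have dDF i := is_diff_coord i (derive_diff2 v oU Ua CF).
have dS := is_diff_sum (index_enum 'I_n) predT (fun i => is_diff_scale (dDF i) (dDPF i)).
rewrite (is_derive_diff u (near_eq_is_diff E1 dS)) /= big_split /= addrC.
congr (_ + _).
  by rewrite -deriveE; [rewrite dPe|exact: dP].
(* With the direction frozen at ['d F a v], the same basis expansion folds the remaining sum back
   into one second derivative of [P]. *)
have E2 : \forall x \near F a, \sum_i ('d F a v) 0 i *: 'D_('e_i) P x = 'D_('d F a v) P x.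
  by apply: filterS nU' => x U'x; rewrite dPe.
have dS2 := is_diff_sum (index_enum 'I_n) predT
  (fun i => is_diff_scale (is_diff_cst (('d F a v) 0 i : R^o) (F a)) (dDP i)).
rewrite (is_derive_diff ('d F a u) (near_eq_is_diff E2 dS2)) /=.
apply: eq_bigr => i _; rewrite scale0r addr0 deriveE //; exact: dF.
Qed.

End SecondDerivatives.

Section LocalRep.
Context {R : realType} {m n : nat} {M : manifold R m} {N : manifold R n}.
Implicit Types (phi : M -> N) (p : M).

Definition local_rep phi p : 'rV[R]_m -> 'rV[R]_n := (mchart (phi p) \o phi) \o minv p.

Definition rep_dom phi p : set 'rV[R]_m :=
  mchart p @` (phi @^-1` mdom (phi p) `&` mdom p).

Lemma open_rep_dom phi p : smooth_map phi -> open (rep_dom phi p).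
Proof.
move=> [cphi _]; apply: open_mchart_image; apply: open_comp => //.
exact: mdom_open.
Qed.

Lemma rep_dom_self phi p : rep_dom phi p (mchart p p).
Proof. by exists p => //; split; exact: mdom_self. Qed.

Lemma local_rep_smooth phi p : smooth_map phi -> Csmooth (rep_dom phi p) (local_rep phi p).
Proof. by move=> [_ sphi]; exact: sphi. Qed.

Lemma local_rep_self phi p : local_rep phi p (mchart p p) = mchart (phi p) (phi p).
Proof. by rewrite /local_rep /= mchartK //; exact: mdom_self. Qed.

(** Identifies, near [p] and not just at [p], the vector field along [phi] that the Hessian
    differentiates with a first derivative of [local_rep]; its own derivative is thus a second
    derivative. *)
Lemma near_tmap_chart phi p v : smooth_map phi -> \forall x \near p,
  btriv (TM N) (phi p) (phi x) (tmap phi x (cfield p v x))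
  = 'D_v (local_rep phi p) (mchart p x).
Proof.
move=> sphi; have [cphi _] := sphi.
have n1 : nbhs p (phi @^-1` mdom (phi p)).
  by apply: cphi; apply: nbhs_mdom; exact: mdom_self.
apply: filterS2 n1 (nbhs_mdom (mdom_self p)) => x dphix dx.
have dm := mdifferentiable_mchart dphix.
rewrite /= -mdiff_comp //.
by rewrite (is_derive_diff v (is_diff_chart dx (mdifferentiable_comp sphi dm))).
Qed.

Lemma is_diff_tmap_chart phi p v : smooth_map phi ->
  is_diff (mchart p p)
    ((fun x => btriv (TM N) (phi p) (phi x) (tmap phi x (cfield p v x)) : 'rV[R]_n) \o minv p)
    (fun u => 'D_u ('D_v (local_rep phi p)) (mchart p p)).
Proof.
move=> sphi.
have D := derive_diff2 v (open_rep_dom sphi) (rep_dom_self phi p)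
  (local_rep_smooth p sphi 2).
apply: (near_eq_is_diff _ D).
have := near_minv (mdom_self p) (near_tmap_chart p v sphi).
apply: filterS2 (near_mdom_chart (mdom_self p)) => y yE /= ->.
by rewrite yE.
Qed.

End LocalRep.

(** * Gram matrices and musical isomorphisms *)

Section Gram.
Context {R : realType} {n : nat} {N : manifold R n} (G : N -> 'M[R]_n).
Implicit Types (p : N) (u v w : 'rV[R]_n).

Lemma ip_linearl p w : scalar (fun u => ip G p u w).
Proof. by move=> a u v; rewrite /ip !mulmxDl -!scalemxAl !mxE. Qed.

Lemma ip_linearr p u : scalar (fun w => ip G p u w).
Proof. by move=> a v w; rewrite /ip linearP mulmxDr -scalemxAr !mxE. Qed.

Lemma ipDl p u v w : ip G p (u + v) w = ip G p u w + ip G p v w.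
Proof. by have := ip_linearl p w 1 u v; rewrite !scale1r mul1r. Qed.

Lemma ipZl p a u w : ip G p (a *: u) w = a * ip G p u w.
Proof.
have ip0 : ip G p 0 w = 0 by rewrite /ip !mul0mx mxE.
by have := ip_linearl p w a u 0; rewrite !addr0 ip0 addr0.
Qed.

Lemma ipDr p u v w : ip G p w (u + v) = ip G p w u + ip G p w v.
Proof. by have := ip_linearr p w 1 u v; rewrite !scale1r mul1r. Qed.

Lemma ipZr p a u w : ip G p w (a *: u) = a * ip G p w u.
Proof.
have ip0 : ip G p w 0 = 0 by rewrite /ip linear0 mulmx0 mxE.
by have := ip_linearr p w a u 0; rewrite !addr0 ip0 addr0.
Qed.

Lemma ip_sum p u v : ip G p u v = \sum_i \sum_j u 0 i * v 0 j * ip G p 'e_i 'e_j.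
Proof.
have ip0l w : ip G p 0 w = 0 by rewrite /ip !mul0mx mxE.
have ip0r w : ip G p w 0 = 0 by rewrite /ip linear0 mulmx0 mxE.
rewrite {1}(row_sum_delta u) (big_morph (fun z => ip G p z v) (fun x y => ipDl p x y v) (ip0l v)).
apply: eq_bigr => i _; rewrite ipZl {1}(row_sum_delta v).
rewrite (big_morph (fun z => ip G p 'e_i z) (fun x y => ipDr p x y 'e_i) (ip0r _)) mulr_sumr.
by apply: eq_bigr => j _; rewrite ipZr mulrA.
Qed.

Lemma ip_sharp p alpha w : G p \in unitmx ->
  ip G p (sharp G p alpha) w = \sum_i alpha 0 i * w 0 i.
Proof.
move=> uG; rewrite /ip /sharp mulmxKV // mxE.
by apply: eq_bigr => i _; rewrite !mxE.
Qed.

End Gram.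

(** * Levi-Civita connections and isometries *)

Section LinearRow.
Context {R : realType} {n : nat}.

Lemma linear_row_sum (W : lmodType R) (f : 'rV[R]_n -> W) w : linear f ->
  f w = \sum_k w 0 k *: f 'e_k.
Proof.
move=> lf; pose fM := GRing.isLinear.Build _ _ _ _ _ lf.
pose fL : {linear 'rV[R]_n -> W} := HB.pack f fM.
rewrite -[f]/(fL : _ -> _) {1}(row_sum_delta w) linear_sum.
by apply: eq_bigr => k _; rewrite linearZ.
Qed.

Lemma scalar_row_sum (f : 'rV[R]_n -> R) w : scalar f ->
  f w = \sum_k w 0 k * f 'e_k.
Proof. by move=> lf; exact: (@linear_row_sum R^o f w lf). Qed.

End LinearRow.

Section MetricDerivative.
Context {R : realType} {n : nat} {N : manifold R n} (G : N -> 'M[R]_n).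
Hypothesis symG : smooth_symmetric G.

Definition chart_gram (r : N) (b c : 'rV[R]_n) (x : N) : R^o :=
  ip G x (cfield r b x) (cfield r c x).

(** In coordinates, a^k b^i c^j d_k g_ij at [r]. *)
Definition dgram (r : N) (a b c : 'rV[R]_n) : R := mdiff (chart_gram r b c) r a.

Lemma mdifferentiable_gram r b c : mdifferentiable (chart_gram r b c) r.
Proof.
have [_ sG] := symG; apply: smooth_on_mdifferentiable (sG r b c).
  exact: mdom_open.
exact: mdom_self.
Qed.

Lemma chart_gram_sum r x (b c : 'rV[R]_n) :
  chart_gram r b c x = \sum_i \sum_j b 0 i *: (c 0 j *: chart_gram r 'e_i 'e_j x).
Proof.
have l1 w : scalar (fun b => ip G x (cfield r b x) w).
  by move=> a u v; rewrite /cfield linearP; exact: ip_linearl.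
have l2 w : scalar (fun c => ip G x w (cfield r c x)).
  by move=> a u v; rewrite /cfield linearP; exact: ip_linearr.
rewrite /chart_gram (scalar_row_sum b (l1 _)); apply: eq_bigr => i _.
by rewrite (scalar_row_sum c (l2 _)) mulr_sumr.
Qed.

Lemma chart_gram_self r b c : chart_gram r b c r = ip G r b c.
Proof. by rewrite /chart_gram !cfield_self. Qed.

Section Along.
Context {m : nat} {M : manifold R m} (phi : M -> N) (sphi : smooth_map phi).

(** The product rule for g_ij beta^i gamma^j along [phi]. It is kept in components because
    bilinearity of [dgram] is itself a consequence, namely the case of the identity map with
    constant fields; with that, [mdiff_chart_gram] folds the sums back. *)
Lemma mdiff_chart_gram_sum p a (beta gamma : M -> 'rV[R]_n) :
  mdifferentiable beta p -> mdifferentiable gamma p ->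
  mdiff (fun x => chart_gram (phi p) (beta x) (gamma x) (phi x)) p a =
  \sum_i \sum_j beta p 0 i * (gamma p 0 j * dgram (phi p) (tmap phi p a) 'e_i 'e_j)
  + \sum_i \sum_j beta p 0 i * (mdiff gamma p a 0 j * ip G (phi p) 'e_i 'e_j)
  + \sum_i \sum_j mdiff beta p a 0 i * (gamma p 0 j * ip G (phi p) 'e_i 'e_j).
Proof.
move=> db dc.
have E : (fun x => chart_gram (phi p) (beta x) (gamma x) (phi x)) \o minv p =
  fun y => \sum_i \sum_j beta (minv p y) 0 i *: (gamma (minv p y) 0 j *:
    chart_gram (phi p) 'e_i 'e_j (phi (minv p y))).
  by apply/funext => y /=; exact: chart_gram_sum.
have dH i j := is_diff_map sphi (mdifferentiable_gram (phi p) 'e_i 'e_j).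
have D := is_diff_sum (index_enum 'I_n) predT (fun i =>
  is_diff_sum (index_enum 'I_n) predT (fun j =>
    is_diff_scale (is_diff_coord i (mdifferentiableP db))
      (is_diff_scale (is_diff_coord j (mdifferentiableP dc)) (dH i j)))).
rewrite /mdiff E (mdiffE (h := fun x => \sum_i \sum_j beta x 0 i *: (gamma x 0 j *:
    chart_gram (phi p) 'e_i 'e_j (phi x))) D).
rewrite -!big_split /=; apply: eq_bigr => i _.
rewrite -!big_split /=; apply: eq_bigr => j _.
rewrite !mchartK; last exact: mdom_self.
by rewrite chart_gram_self scalerDr.
Qed.

End Along.

Lemma mdiff_cst m (M : manifold R m) (W : normedModType R) (w : W) (p : M) a :
  mdiff (fun _ : M => w) p a = 0.
Proof. by rewrite (mdiffE (is_diff_cst w (mchart p p))). Qed.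

Lemma dgram_sum r a (b c : 'rV[R]_n) :
  dgram r a b c = \sum_i \sum_j b 0 i * (c 0 j * dgram r a 'e_i 'e_j).
Proof.
have dc w : mdifferentiable (fun _ : N => w : 'rV[R]_n) r by apply: differentiable_cst.
rewrite {1}/dgram (mdiff_chart_gram_sum (smooth_map_id (M := N)) a (dc b) (dc c)).
rewrite [X in _ + X + _]big1 => [|i _]; last first.
  by rewrite big1 // => j _; rewrite mdiff_cst mxE mul0r mulr0.
rewrite [X in _ + _ + X]big1 => [|i _]; last first.
  by rewrite big1 // => j _; rewrite mdiff_cst mxE mul0r.
rewrite !addr0; apply: eq_bigr => i _; apply: eq_bigr => j _.
by rewrite tmap_id.
Qed.

Lemma mdiff_chart_gram m (M : manifold R m) (phi : M -> N) p a
    (beta gamma : M -> 'rV[R]_n) : smooth_map phi ->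
  mdifferentiable beta p -> mdifferentiable gamma p ->
  mdiff (fun x => chart_gram (phi p) (beta x) (gamma x) (phi x)) p a =
  dgram (phi p) (tmap phi p a) (beta p) (gamma p)
  + ip G (phi p) (mdiff beta p a) (gamma p) + ip G (phi p) (beta p) (mdiff gamma p a).
Proof.
move=> sphi db dc; rewrite (mdiff_chart_gram_sum sphi a db dc) addrAC.
rewrite -dgram_sum; congr (_ + _ + _); rewrite ip_sum.
  by apply: eq_bigr => i _; apply: eq_bigr => j _; rewrite mulrA.
by apply: eq_bigr => i _; apply: eq_bigr => j _; rewrite mulrA.
Qed.

Lemma dgram_scalar2 r a c : scalar (fun b => dgram r a b c).
Proof.
move=> k u v; rewrite !(dgram_sum r a _ c) mulr_sumr -big_split /=.
apply: eq_bigr => i _; rewrite mulr_sumr -big_split /=.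
by apply: eq_bigr => j _; rewrite !mxE mulrDl -mulrA.
Qed.

Lemma dgram_scalar3 r a b : scalar (fun c => dgram r a b c).
Proof.
move=> k u v; rewrite !(dgram_sum r a b) mulr_sumr -big_split /=.
apply: eq_bigr => i _; rewrite mulr_sumr -big_split /=.
by apply: eq_bigr => j _; rewrite !mxE mulrDl -mulrA mulrDr mulrCA.
Qed.

Lemma dgram_scalar1 r b c : scalar (fun a => dgram r a b c).
Proof. by move=> k u v; rewrite /dgram linearP. Qed.

Lemma koszulE r u v w :
  koszul G r u v w = dgram r u v w + dgram r v u w - dgram r w u v.
Proof. by []. Qed.

Let lincomb3 (k a b c a' b' c' : R) :
  (k * a + a') + (k * b + b') - (k * c + c') = k * (a + b - c) + (a' + b' - c').
Proof. by ring. Qed.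

Lemma koszul_scalar2 r u w : scalar (fun v => koszul G r u v w).
Proof.
move=> k x y; rewrite !koszulE (dgram_scalar2 r u w) (dgram_scalar1 r u w).
by rewrite (dgram_scalar3 r w u); exact: lincomb3.
Qed.

Lemma koszul_scalar3 r u v : scalar (fun w => koszul G r u v w).
Proof.
move=> k x y; rewrite !koszulE (dgram_scalar3 r u v) (dgram_scalar3 r v u).
by rewrite (dgram_scalar1 r u v); exact: lincomb3.
Qed.

(* The Christoffel symbols in the chart around [r], evaluated at [r]. *)
Definition christoffel r u v : 'rV[R]_n :=
  sharp G r (\row_i (2^-1 * koszul G r u v 'e_i)).

Let sharp_linear r : linear (sharp G r).
Proof. by move=> k x y; rewrite /sharp mulmxDl scalemxAl. Qed.

Lemma christoffel_linear r u : linear (christoffel r u).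
Proof.
have E (k : R) (x y : 'rV[R]_n) : \row_i (2^-1 * koszul G r u (k *: x + y) 'e_i) =
  k *: (\row_i (2^-1 * koszul G r u x 'e_i)) + \row_i (2^-1 * koszul G r u y 'e_i).
  apply/rowP => i.
  have := koszul_scalar2 r u 'e_i k x y; rewrite !mxE.
  move: (koszul _ _ _ _ _) (koszul _ _ _ _ _) (koszul _ _ _ _ _) => K1 K2 K3 ->.
  by rewrite mulrDr mulrCA.
move=> k x y.
exact: (etrans (congr1 (sharp G r) (E k x y)) (sharp_linear r k _ _)).
Qed.

Lemma ip_christoffel r u v w : G r \in unitmx ->
  ip G r (christoffel r u v) w = 2^-1 * koszul G r u v w.
Proof.
move=> uG; rewrite ip_sharp // (scalar_row_sum w (koszul_scalar3 r u v)) mulr_sumr.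
by apply: eq_bigr => i _; rewrite mxE mulrCA mulrA [_ * w 0 i]mulrC mulrA.
Qed.

Lemma levi_civita_cfield r u v : levi_civita G r u (cfield r v) = christoffel r u v.
Proof.
rewrite /levi_civita cfield_self [X in X + _](_ : _ = 0) ?add0r //.
have n1 : \forall x \near r, v = btriv (TM N) r x (cfield r v x).
  by apply: filterS (nbhs_mdom (mdom_self r)) => x dx; rewrite btriv_cfield.
have dc : mdifferentiable (fun _ : N => v) r by apply: differentiable_cst.
by rewrite (mdiffE (near_eq_mdiff n1 dc)) mdiff_cst.
Qed.

End MetricDerivative.

Lemma btriv_tmap_self (R : realType) m n (M : manifold R m) (N : manifold R n)
    (phi : M -> N) p v :
  btriv (TM N) (phi p) (phi p) (tmap phi p (cfield p v p)) = tmap phi p v.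
Proof. by rewrite btriv_self cfield_self. Qed.

(** * Second fundamental form of a map *)

Section Hessian.
Context {R : realType}.

(** The classical coordinate formula, second derivatives plus Christoffel terms of target and
    source. At the base points the frames are the standard bases, so the sum defining the
    pulled-back connection collapses. *)
Lemma hessianE m n (M : manifold R m) (N : manifold R n) g (G : N -> 'M[R]_n)
    (phi : M -> N) p u v : smooth_symmetric G -> smooth_map phi ->
  hessian g G phi p u v =
  'D_u ('D_v (local_rep phi p)) (mchart p p)
  + christoffel G (phi p) (tmap phi p u) (tmap phi p v)
  - tmap phi p (christoffel g p u v).
Proof.
move=> sG sphi; rewrite /hessian levi_civita_cfield; congr (_ - _).
pose X := 'D_u ('D_v (local_rep phi p)) (mchart p p).
have D : mdiff (fun x => btriv (TM N) (phi p) (phi x) (tmap phi x (cfield p v x))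
    : 'rV[R]_n) p u = X.
  by rewrite (mdiffE (is_diff_tmap_chart p v sphi)).
have D0 := btriv_tmap_self phi p v.
transitivity (\sum_a (X 0 a *: ('e_a : 'rV[R]_n) + tmap phi p v 0 a *:
    christoffel G (phi p) (tmap phi p u) 'e_a)).
  apply: eq_bigr => a _; congr (_ + _).
    by congr (_ *: _); [rewrite -D|exact: cfield_self].
  by congr (_ *: _); [rewrite -D0|exact: levi_civita_cfield].
rewrite big_split /= -row_sum_delta; congr (_ + _).
by rewrite [RHS](linear_row_sum _ (christoffel_linear sG (phi p) (tmap phi p u))).
Qed.

Let cancel_terms (V : zmodType) (a b c d e : V) :
  a + b + c - d = a + e - d + (b + c - e).
Proof. by rewrite [RHS]addrACA (addrAC a e) [RHS]addrACA subrr addr0 addrA. Qed.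

(** The second-order chain rule produces the two second-derivative terms; the Christoffel term of
    the middle metric appears once with each sign and cancels. *)
Lemma hessian_comp m n k (M : manifold R m) (N : manifold R n) (P : manifold R k)
    g (G : N -> 'M[R]_n) (H : P -> 'M[R]_k) (phi : M -> N) (psi : N -> P) p u v :
  smooth_symmetric G -> smooth_symmetric H -> smooth_map phi -> smooth_map psi ->
  hessian g H (psi \o phi) p u v =
  tmap psi (phi p) (hessian g G phi p u v)
  + hessian G H psi (phi p) (tmap phi p u) (tmap phi p v).
Proof.
move=> sG sH sphi spsi; set r := phi p; have [cphi _] := sphi; have [cpsi _] := spsi.
have E1 := hessianE g p u v sG sphi.
have E2 := hessianE G r (tmap phi p u) (tmap phi p v) sH spsi.
have E3 := hessianE g p u v sH (smooth_map_comp sphi spsi).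
rewrite {}E3 {}E1 {}E2.
pose A := psi @^-1` mdom (psi r) `&` mdom r.
have oA : open A.
  by apply: openI; [apply: open_comp => //|]; exact: mdom_open.
(* A smaller coordinate domain, on which the representation of [psi \o phi] is the composite of the
   representations of [phi] and [psi]. *)
pose U := mchart p @` (phi @^-1` A `&` mdom p).
have oU : open U by apply: open_mchart_image; exact: open_comp.
have Ua : U (mchart p p) by exists p => //; split; [split|]; exact: mdom_self.
have sU : U `<=` local_rep phi p @^-1` rep_dom psi r.
  by move=> _ [x [[Ax rx] dx] <-]; exists (phi x) => //; rewrite /local_rep /= mchartK.
have CF : Ck 2 U (local_rep phi p).
  by apply: Ck_subset (local_rep_smooth p sphi 2) => _ [x [[Ax rx] dx] <-]; exists x.
have D2 := derive2_comp u v oU (open_rep_dom spsi) Ua sU CF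
  (local_rep_smooth r spsi 2).
have E : forall y, U y -> local_rep (psi \o phi) p y = (local_rep psi r \o local_rep phi p) y.
  by move=> _ [x [[Ax rx] dx] <-]; rewrite /local_rep /= !mchartK.
have nU y : U y -> nbhs y U by move=> Uy; exact: open_nbhs_nbhs.
have -> : 'D_u ('D_v (local_rep (psi \o phi) p)) (mchart p p) =
          'D_u ('D_v (local_rep psi r \o local_rep phi p)) (mchart p p).
  apply: near_eq_derive; apply: filterS (nU _ Ua) => y Uy.
  by apply: near_eq_derive; apply: filterS (nU _ Uy) => z /E.
rewrite D2 local_rep_self !(tmap_comp p _ sphi spsi).
rewrite linearB linearD; exact: cancel_terms.
Qed.

End Hessian.

(** * Isometries are totally geodesic *)

Section Isometry.
Context {R : realType} {n : nat} {N : manifold R n} (G : N -> 'M[R]_n) (psi : N -> N).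
Hypotheses (symG : smooth_symmetric G) (unitG : forall q, G q \in unitmx).
Hypothesis (spsi : smooth_map psi).
Hypothesis isom : forall q u v, ip G (psi q) (tmap psi q u) (tmap psi q v) = ip G q u v.

Lemma ipC q u v : ip G q u v = ip G q v u.
Proof.
have [tG _] := symG.
have E : u *m G q *m v^T = (v *m G q *m u^T)^T by rewrite !trmx_mul trmxK tG mulmxA.
by rewrite /ip E mxE.
Qed.

Lemma ip_nondegenerate q u : (forall v, ip G q u v = 0) -> u = 0.
Proof.
move=> u0; have : u *m G q = 0.
  apply/rowP => i; have := u0 'e_i; rewrite /ip mxE (bigD1 i) //= big1 => [|j ji].
    by rewrite !mxE !eqxx mulr1 addr0.
  by rewrite !mxE (negbTE ji) andbF mulr0.
by move=> /(congr1 (mulmx^~ (invmx (G q)))); rewrite mul0mx mulmxK.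
Qed.

Let S r a b := 'D_a ('D_b (local_rep psi r)) (mchart r r).

(** Here [s] is the product of the second derivative of [psi] with the test vector and [k1], [k2],
    [k3] are the Koszul terms at the image point. The terms [t1], [t2] cancel by sign, while [s]
    occurs twice and is halved by the Koszul factor. *)
Let koszul_cancel (s k1 k2 k3 t1 t2 : R) :
  s + 2^-1 * (k1 + k2 - k3)
  - 2^-1 * (k1 + s + t1 + (k2 + s + t2) - (k3 + t1 + t2)) = 0.
Proof. by field. Qed.

(** Differentiates the isometry equation on fields with constant components around [r]. In the chart
    around [psi r] their images have varying components, whose derivatives are the terms [S]. *)
Lemma dgram_isometry r a b c : dgram G r a b c =
  dgram G (psi r) (tmap psi r a) (tmap psi r b) (tmap psi r c)
  + ip G (psi r) (S r a b) (tmap psi r c) + ip G (psi r) (tmap psi r b) (S r a c).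
Proof.
pose beta w x : 'rV[R]_n := btriv (TM N) (psi r) (psi x) (tmap psi x (cfield r w x)).
have Db w := is_diff_tmap_chart r w spsi.
have db w : mdifferentiable (beta w) r by have [] := Db w.
have [cpsi _] := spsi.
have n1 : nbhs r (psi @^-1` mdom (psi r)).
  by apply: cpsi; apply: nbhs_mdom; exact: mdom_self.
have nE : \forall x \near r, chart_gram G r b c x =
    chart_gram G (psi r) (beta b x) (beta c x) (psi x).
  apply: filterS n1 => x dx.
  by rewrite /chart_gram /beta !cfield_btriv // isom.
rewrite {1}/dgram -(mdiffE (near_eq_mdiff nE (mdifferentiable_gram symG r b c))).
rewrite (mdiff_chart_gram symG a spsi (db b) (db c)).
have b0 w : beta w r = tmap psi r w.
  exact: btriv_tmap_self.
have Mb w : mdiff (beta w) r a = S r a w.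
  exact: (congr1 (fun h => h a) (mdiffE (Db w))).
clear Db nE; clearbody beta.
suff F x1 y1 x2 y2 : x1 = tmap psi r b -> y1 = tmap psi r c ->
    x2 = S r a b -> y2 = S r a c ->
    dgram G (psi r) (tmap psi r a) x1 y1 + ip G (psi r) x2 y1 + ip G (psi r) x1 y2
    = dgram G (psi r) (tmap psi r a) (tmap psi r b) (tmap psi r c)
      + ip G (psi r) (S r a b) (tmap psi r c) + ip G (psi r) (tmap psi r b) (S r a c).
  exact: (F _ _ _ _ (b0 b) (b0 c) (Mb b) (Mb c)).
by move=> -> -> -> ->.
Qed.

(** Tested against vectors in the image of the differential, so that the isometry equation moves the
    Christoffel term of the source back to [r]; surjectivity of the differential makes these all
    vectors. *)
Lemma hessian_isometry r w z : (forall u, exists v, tmap psi r v = u) ->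
  hessian G G psi r w z = 0.
Proof.
move=> surj; apply: (@ip_nondegenerate (psi r)) => y'; have [y <-] := surj y'.
have E := hessianE G r w z symG spsi; rewrite {}E.
have S_sym a b : S r a b = S r b a.
  exact: (derive_swap_row b a (open_rep_dom spsi) (rep_dom_self psi r) (local_rep_smooth r spsi 2)).
rewrite ipDl ipDl -scaleN1r ipZl mulN1r isom !ip_christoffel // !koszulE.
rewrite (dgram_isometry r w z y) (dgram_isometry r z w y) (dgram_isometry r y w z).
rewrite (S_sym z w) (S_sym z y) (S_sym w y) -/(S r w z).
rewrite (ipC (psi r) (tmap psi r w)) (ipC (psi r) (tmap psi r z)).
exact: koszul_cancel.
Qed.

Lemma tension_isometry m (M : manifold R m) g (phi : M -> N) p :
  (forall r u, exists v, tmap psi r v = u) -> smooth_map phi ->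
  tension g G (psi \o phi) p = tmap psi (phi p) (tension g G phi p).
Proof.
move=> surj sphi; rewrite /tension linear_sum; apply: eq_bigr => a _.
rewrite linear_sum; apply: eq_bigr => b _; rewrite linearZ; congr (_ *: _).
rewrite (hessian_comp g p _ _ symG symG sphi spsi).
by rewrite hessian_isometry ?addr0.
Qed.

End Isometry.

(** * Field equations *)

Section DualityOnBase.
Context {R : realType} {n : nat} {Sigma : scalar_structure R n}
  {Delta : duality_structure Sigma}.
Variables (f : unbased_aut Delta) (hf : em_duality f).
Local Notation G := (smetric Sigma).
Local Notation psi := (bmbase f).
Local Notation psi' := (bmbase (ubinv f)).

Lemma riemannian_unitmx q : G q \in unitmx.
Proof.
have [_ posG] := smetric_riemannian Sigma.
rewrite -row_free_unit; apply: inj_row_free => v vG.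
apply/eqP/negPn/negP => /(posG q).
by rewrite /ip vG mul0mx mxE ltxx.
Qed.

Lemma metric_symmetric : smooth_symmetric G.
Proof. by have [] := smetric_riemannian Sigma. Qed.

Lemma base_smooth : smooth_map psi. Proof. exact: bmbase_smooth. Qed.

Lemma tmap_baseK q w : tmap psi q (tmap psi' (psi q) w) = w.
Proof.
have E : psi \o psi' = id by apply/funext => x; exact: bmbase_invK.
have C := tmap_comp (psi q) w (bmbase_smooth (ubinv f)) (bmbase_smooth f).
have I := tmap_id (psi q) w.
rewrite bmbaseK in C; rewrite -C.
by rewrite -[RHS]I E.
Qed.

Lemma isom_base q u v : ip G (psi q) (tmap psi q u) (tmap psi q v) = ip G q u v.
Proof. by have [iso _] := em_base hf; exact: iso. Qed.

Lemma tmap_base_inj q u : tmap psi q u = 0 -> u = 0.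
Proof.
move=> u0; apply: (ip_nondegenerate riemannian_unitmx (q := q)) => v.
by rewrite -isom_base u0 /ip !mul0mx mxE.
Qed.

(** The hypothesis says that [alpha] is the pull-back of [alpha']. Both the gradient and the source
    term of the scalar equation are transported through this statement. *)
Lemma sharp_push q (alpha alpha' : 'rV[R]_n) :
  (forall u, \sum_i alpha' 0 i * tmap psi q u 0 i = \sum_i alpha 0 i * u 0 i) ->
  sharp G (psi q) alpha' = tmap psi q (sharp G q alpha).
Proof.
move=> aE; apply/eqP; rewrite -subr_eq0; apply/eqP.
apply: (ip_nondegenerate riemannian_unitmx (q := psi q)) => w.
have [v <-] : exists v, tmap psi q v = w by exists (tmap psi' (psi q) w); exact: tmap_baseK.
rewrite ipDl -scaleN1r ipZl mulN1r isom_base !ip_sharp ?riemannian_unitmx //.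
by rewrite aE; exact: subrr.
Qed.

Lemma sum_row_coords (h : 'rV[R]_n -> R) (u : 'rV[R]_n) : scalar h ->
  \sum_i (\row_i h 'e_i : 'rV[R]_n) 0 i * u 0 i = h u.
Proof.
by move=> /scalar_row_sum ->; apply: eq_bigr => i _; rewrite mxE mulrC.
Qed.

Lemma grad_push q :
  grad G (spotential Sigma) (psi q) = tmap psi q (grad G (spotential Sigma) q).
Proof.
apply: sharp_push => u.
have sP := @spotential_smooth R n Sigma.
have dP x : mdifferentiable (spotential Sigma) x.
  by apply: smooth_on_mdifferentiable sP => //; exact: openT.
have lin x : scalar (mdiff (spotential Sigma) x) by move=> a y z; rewrite linearP.
rewrite (sum_row_coords _ (lin _)) (sum_row_coords _ (lin _)).
have C := mdiff_comp u base_smooth (dP (psi q)).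
apply: etrans (esym C) _.
congr (mdiff _ q u); apply/funext => x; have [_ inv] := em_base hf; exact: inv.
Qed.

Lemma tension_push m (M : manifold R m) g (phi : M -> Sigma) p : smooth_map phi ->
  tension g G (psi \o phi) p = tmap psi (phi p) (tension g G phi p).
Proof.
apply: (tension_isometry metric_symmetric riemannian_unitmx base_smooth isom_base).
by move=> r u; exists (tmap psi' (psi r) u); exact: tmap_baseK.
Qed.

End DualityOnBase.

Section TwoFormsPush.
Context {R : realType} {M : manifold R 4} (g : M -> 'M[R]_4).

Lemma hodge_linear (W W' : lmodType R) (L : {linear W -> W'}) p
    (beta : 'rV[R]_4 -> 'rV[R]_4 -> W) u v :
  hodge g p (fun a b => L (beta a b)) u v = L (hodge g p beta u v).
Proof.
rewrite /hodge [RHS]linearZ /=; congr (_ *: _).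
rewrite linear_sum; apply: eq_bigr => a _; rewrite linear_sum; apply: eq_bigr => b _.
rewrite linear_sum; apply: eq_bigr => c _.
by rewrite linear_sum; apply: eq_bigr => d _; rewrite linearZ.
Qed.

Lemma form_pairing_lincomb (W : lmodType R) p (Q : W -> W -> R) k (c : 'I_k -> R)
    alpha (beta : 'I_k -> 'rV[R]_4 -> 'rV[R]_4 -> W) :
  (forall x, scalar (Q x)) ->
  form_pairing g p Q alpha (fun u v => \sum_j c j *: beta j u v) =
  \sum_j c j * form_pairing g p Q alpha (beta j).
Proof.
move=> linQ.
have QE x (z : 'I_k -> W) : Q x (\sum_j c j *: z j) = \sum_j c j * Q x (z j).
  pose QM := GRing.isLinear.Build _ _ _ _ _ (linQ x).
  pose QL : {scalar W} := HB.pack (Q x) QM.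
  rewrite -[Q x]/(QL : _ -> _) linear_sum.
  by apply: eq_bigr => j _; rewrite linearZ.
rewrite /form_pairing.
under [RHS]eq_bigr => j _ do rewrite mulrCA.
rewrite -[RHS]mulr_sumr; congr (_ * _).
under [RHS]eq_bigr => j _ do rewrite mulr_sumr.
rewrite [in RHS]exchange_big /=.
apply: eq_bigr => a _; under [RHS]eq_bigr => j _ do rewrite mulr_sumr.
rewrite [in RHS]exchange_big /=; apply: eq_bigr => b _.
under [RHS]eq_bigr => j _ do rewrite mulr_sumr.
rewrite [in RHS]exchange_big /=; apply: eq_bigr => d _.
under [RHS]eq_bigr => j _ do rewrite mulr_sumr.
rewrite [in RHS]exchange_big /=; apply: eq_bigr => e _.
by rewrite QE mulr_sumr; apply: eq_bigr => j _; rewrite mulrCA.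
Qed.

End TwoFormsPush.

(** * The source term of the scalar equation *)

Section PsiPush.
Context {R : realType} {n : nat} {M : oriented_manifold R 4}.
Context {Sigma : scalar_structure R n} {Delta : duality_structure Sigma}.
Variables (J : endo_field Delta) (hJ : taming J) (g : M -> 'M[R]_4).
Arguments J : clear implicits.

(* The covector [v |-> (star_g V, Theta(v) V)]. *)
Definition theta_form (J : endo_field Delta) (phi : M -> Sigma)
    (V : twoform_along Delta phi) p (v : 'rV[R]_n) : R :=
  form_pairing g p (taming_form J (phi p)) (hodge g p (V p))
    (fun a b => Theta J v (V p a b)).

Lemma taming_form_linearr (K : endo_field Delta) q x : scalar (taming_form K q x).
Proof. exact: dform_linearr. Qed.

(** Index raising commutes with the pairing, which is linear in its second argument. Symmetry of the
    metric reconciles the row of the inverse used in [Psi] with the column used in [sharp]. *)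
Lemma Psi_pairing_sharp K phi (V : twoform_along Delta phi) p :
  Psi_pairing K g V p = sharp (smetric Sigma) (phi p) (\row_j theta_form K V p 'e_j).
Proof.
apply/rowP => i; rewrite /sharp !mxE /Psi.
rewrite (form_pairing_lincomb _ _ _ _ _ (@taming_form_linearr K (phi p))).
apply: eq_bigr => j _; rewrite mxE mulrC; congr (_ * _).
have [tG _] := metric_symmetric (Sigma := Sigma).
by rewrite -[in LHS](tG (phi p)) -trmx_inv mxE.
Qed.

Lemma theta_form_scalar phi (V : twoform_along Delta phi) p : scalar (theta_form J V p).
Proof.
move=> k u v; rewrite /theta_form.
(* The combination [k *: u + v] is written as a sum over two indices in order to reuse
   [form_pairing_lincomb]. *)
pose c (j : 'I_2) : R := if j == 0 then k else 1.
pose w (j : 'I_2) : 'rV[R]_n := if j == 0 then u else v.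
have E : (fun a b => Theta J (k *: u + v) (V p a b)) =
    (fun a b => \sum_j c j *: Theta J (w j) (V p a b)).
  apply/funext => a; apply/funext => b; rewrite (Theta_linear hJ).
  by rewrite big_ord_recl big_ord1 /c /w /= scale1r.
rewrite E (form_pairing_lincomb _ _ _ _ _ (@taming_form_linearr J (phi p))).
by rewrite big_ord_recl big_ord1 /c /w /= mul1r.
Qed.

Variables (f : unbased_aut Delta) (hf : em_duality f).

Definition push_form (phi : M -> Sigma) (V : twoform_along Delta phi) :
    twoform_along Delta (bmbase f \o phi) := fun p u v => f (phi p) (V p u v).

Lemma taming_form_push q (x y : Delta q) :
  taming_form (Ad f J) (bmbase f q) (f q x) (f q y) = taming_form J q x y.
Proof. by rewrite /taming_form AdE (em_symplectic hf). Qed.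

Lemma hodge_push phi (V : twoform_along Delta phi) p u v :
  hodge g p (push_form V p) u v = f (phi p) (hodge g p (V p) u v).
Proof. exact: hodge_linear. Qed.

Lemma theta_form_push phi (V : twoform_along Delta phi) p v :
  theta_form (Ad f J) (push_form V) p (tmap (bmbase f) (phi p) v) = theta_form J V p v.
Proof.
rewrite /theta_form /form_pairing; congr (_ * _).
apply: eq_bigr => a _; apply: eq_bigr => b _; apply: eq_bigr => c _.
apply: eq_bigr => d _; congr (_ * _).
rewrite hodge_push (Theta_push hJ) ?taming_form_push //; exact: em_covconst.
Qed.

Lemma Psi_pairing_push phi (V : twoform_along Delta phi) p :
  Psi_pairing (Ad f J) g (push_form V) p = tmap (bmbase f) (phi p) (Psi_pairing J g V p).
Proof.
rewrite !Psi_pairing_sharp; apply: (sharp_push hf) => u.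
(* Every [w] is the image of a vector under the differential of [f_0]; hence linearity for [Ad f J]
   is inherited from linearity for [J]. *)
have E w : theta_form (Ad f J) (push_form V) p w =
    theta_form J V p (tmap (bmbase (ubinv f)) (bmbase f (phi p)) w).
  by rewrite -theta_form_push; congr (theta_form _ _ _ _); exact: esym (tmap_baseK _ _ _).
have lin' : scalar (theta_form (Ad f J) (push_form V) p).
  by move=> k x y; rewrite (E (k *: x + y)) (E x) (E y) linearP; exact: theta_form_scalar.
rewrite (sum_row_coords _ lin') (sum_row_coords _ (theta_form_scalar V p)).
exact: theta_form_push.
Qed.

End PsiPush.

(** * Transport of configurations and solutions *)

Section Configurations.
Context {R : realType} {n : nat} {M : oriented_manifold R 4}.
Context {Sigma : scalar_structure R n} {Delta : duality_structure Sigma}.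
Implicit Types (phi : M -> Sigma) (f : unbased_aut Delta).

Lemma smooth_twoform_push f phi (V : twoform_along Delta phi) :
  smooth_map phi -> smooth_twoform V -> smooth_twoform (push_form f V).
Proof.
move=> sphi [l1 l2 alt sV]; split.
- by move=> p v k a b; rewrite /push_form (l1 p v) linearP.
- by move=> p u k a b; rewrite /push_form (l2 p u) linearP.
- by move=> p u; rewrite /push_form alt linear0.
- move=> p i u v.
  exact: (@smooth_along_bundle_map _ _ _ _ _ M phi f (mdom p)
    (fun x => V x (cfield p u x) (cfield p v x)) sphi (mdom_open p)
    (fun j => sV p j u v) i).
Qed.

(** Smoothness of [V] is given on fields with constant components; general fields are expanded in
    these by bilinearity. It provides the differentiability that [pullback_cov_push] asks for. *)
Lemma mdifferentiable_twoform phi (V : twoform_along Delta phi) U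
    (Y Z : M -> 'rV[R]_4) p : smooth_map phi -> smooth_twoform V -> open U -> U p ->
  smooth_section (B := TM M) U Y -> smooth_section (B := TM M) U Z ->
  mdifferentiable (fun x => btriv Delta (phi p) (phi x) (V x (Y x) (Z x))) p.
Proof.
move=> sphi [l1 l2 _ sV] oU Up sY sZ; have [cphi _] := sphi.
pose A := mdom p `&` phi @^-1` bdom Delta (phi p).
have oA : open A.
  by apply: openI; [exact: mdom_open|apply: open_comp => //; exact: bdom_open].
have Ap : A p by split; [exact: mdom_self|exact: bdom_self].
pose y (X : M -> 'rV[R]_4) x : 'rV[R]_4 := btriv (TM M) p x (X x).
have dy X : smooth_section (B := TM M) U X -> mdifferentiable (y X) p.
  move=> sX; apply: smooth_on_mdifferentiable (sX p).
    by apply: openI => //; exact: mdom_open.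
  by split=> //; exact: mdom_self.
pose H (i j : 'I_4) x := btriv Delta (phi p) (phi x) (V x (cfield p 'e_i x) (cfield p 'e_j x)).
have dH i j : mdifferentiable (H i j) p.
  exact: smooth_on_mdifferentiable (sV p (phi p) 'e_i 'e_j).
have D := is_diff_sum (index_enum 'I_4) predT (fun i =>
  is_diff_sum (index_enum 'I_4) predT (fun j =>
    is_diff_scale (is_diff_coord i (mdifferentiableP (dy Y sY)))
      (is_diff_scale (is_diff_coord j (mdifferentiableP (dy Z sZ)))
        (mdifferentiableP (dH i j))))).
apply: near_eq_differentiable (is_diff_differentiable D).
have nA := near_minv (mdom_self p) (open_nbhs_nbhs (conj oA Ap)).
apply: filterS nA => z; rewrite /=; move: (minv p z) => x [dx ix].
have EY : Y x = cfield p (y Y x) x by rewrite cfield_btriv.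
have EZ : Z x = cfield p (y Z x) x by rewrite cfield_btriv.
rewrite [in RHS]EY [in RHS]EZ; move: (y Y x) (y Z x) => b c.
have k1 w : linear (fun b => V x (cfield p b x) w).
  by move=> a u v; rewrite /cfield linearP; exact: l1.
have k2 w : linear (fun c => V x w (cfield p c x)).
  by move=> a u v; rewrite /cfield linearP; exact: l2.
rewrite (linear_row_sum b (k1 _)) linear_sum; apply: eq_bigr => i _.
rewrite linearZ (linear_row_sum c (k2 _)) linear_sum /= scaler_sumr; apply: eq_bigr => j _.
by congr (_ *: _); rewrite linearZ.
Qed.

Lemma twisted_d_push f phi (V : twoform_along Delta phi) U (X Y Z : M -> 'rV[R]_4) p :
  covariantly_constant f -> smooth_map phi -> smooth_twoform V -> open U -> U p ->
  smooth_section (B := TM M) U X -> smooth_section (B := TM M) U Y ->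
  smooth_section (B := TM M) U Z ->
  twisted_d (push_form f V) X Y Z p = f (phi p) (twisted_d V X Y Z p).
Proof.
move=> cf sphi sV oU Up sX sY sZ.
have E A B C : smooth_section (B := TM M) U B -> smooth_section (B := TM M) U C ->
    pullback_cov (dconn Delta) (bmbase f \o phi) p A
      (fun x => push_form f V x (B x) (C x)) =
    f (phi p) (pullback_cov (dconn Delta) phi p A (fun x => V x (B x) (C x))).
  move=> sB sC; apply: (pullback_cov_push (s := fun x => V x (B x) (C x)) _ cf sphi).
  exact: mdifferentiable_twoform sB sC.
rewrite [RHS]linearB [in RHS]linearB [in RHS]linearB [in RHS]linearD [in RHS]linearD.
by rewrite -(E _ Y Z sY sZ) -(E _ Z X sZ sX) -(E _ X Y sX sY).
Qed.

(** Comparing values in the total space avoids any transport between forms along two different maps;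
    the base maps are recovered from the first projections. *)
Lemma preconf_eq phi1 phi2 (V1 : twoform_along Delta phi1) (V2 : twoform_along Delta phi2) :
  (forall p u v, existT (fun q => Delta q) (phi1 p) (V1 p u v)
               = existT (fun q => Delta q) (phi2 p) (V2 p u v)) ->
  existT (twoform_along Delta) phi1 V1 = existT (twoform_along Delta) phi2 V2.
Proof.
move=> E; have Ephi : phi1 = phi2.
  by apply/funext => p; exact: (congr1 (@projT1 _ _) (E p 0 0)).
case: _ / Ephi in V2 E *; congr existT.
apply: functional_extensionality_dep => p; apply/funext => u; apply/funext => v.
by apply: (@existT_inj _ _ _ (fun q => Delta q)).
Qed.

Lemma duality_actionK f : cancel (duality_action (M := M) (inv_aut f)) (duality_action f).
Proof.
by move=> [phi V]; apply: preconf_eq => p u v; exact: (ubinvK f (existT _ (phi p) (V p u v))).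
Qed.

Section Solutions.
Variables (J : endo_field Delta) (hJ : taming J) (g : M -> 'M[R]_4).
Arguments J : clear implicits.
Variables (f : unbased_aut Delta) (hf : em_duality f).

(** Right to left gives one inclusion of the theorem; left to right, applied to the image under the
    inverse of [f], gives the other. The field equations are reflected because [f] and the
    differential of [f_0] are injective. *)
Lemma Sol_push phi (V : twoform_along Delta phi) :
  smooth_map phi -> smooth_twoform V ->
  Sol (Ad f J) g (duality_action f (existT _ phi V)) <-> Sol J g (existT _ phi V).
Proof.
move=> sphi sV.
have sphi' : smooth_map (bmbase f \o phi) by apply: smooth_map_comp => //; exact: bmbase_smooth.
have sV' := smooth_twoform_push f sphi sV.
have H p u v : hodge g p (push_form f V p) u v = - Ad f J (push_form f V p u v) <->
               hodge g p (V p) u v = - J (phi p) (V p u v).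
  rewrite hodge_push AdE -linearN; split=> [|-> //].
  exact: unbased_aut_inj.
have T p : tension g (smetric Sigma) (bmbase f \o phi) p
      - grad (smetric Sigma) (spotential Sigma) (bmbase f (phi p))
      - 2^-1 *: Psi_pairing (Ad f J) g (push_form f V) p =
    tmap (bmbase f) (phi p) (tension g (smetric Sigma) phi p
      - grad (smetric Sigma) (spotential Sigma) (phi p) - 2^-1 *: Psi_pairing J g V p).
  rewrite [RHS]linearB [in RHS]linearB [in RHS]linearZ /=.
  congr (_ - _ - _ *: _).
  - exact: (tension_push hf).
  - exact: (grad_push hf).
  - exact: (Psi_pairing_push hJ).
split=> [[[_ _ hodge'] [tens tw]]|[[_ _ hodgeV] [tens tw]]].
- split; first by split=> // p u v; apply/H; exact: hodge'.
  split=> [p|U X Y Z p oU Up sX sY sZ].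
    by apply: (tmap_base_inj hf (q := phi p)); apply: etrans (esym (T p)) _; exact: tens.
  apply: (unbased_aut_inj (f := f)).
  rewrite -(twisted_d_push (em_covconst hf) sphi sV oU Up sX sY sZ) linear0.
  exact: (tw U X Y Z p oU Up sX sY sZ).
- split; first by split=> // p u v; apply/H; exact: hodgeV.
  split=> [p|U X Y Z p oU Up sX sY sZ].
    by apply: etrans (T p) _; rewrite tens linear0.
  apply: etrans (twisted_d_push (em_covconst hf) sphi sV oU Up sX sY sZ) _.
  by rewrite (tw U) // linear0.
Qed.

End Solutions.

End Configurations.

Theorem theorem3p15 (R : realType) (n : nat) (M : oriented_manifold R 4)
  (Sigma : scalar_structure R n) (Delta : duality_structure Sigma)
  (J : endo_field Delta) (hJ : taming J)
  (g : M -> 'M[R]_4) (hg : lorentzian g)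
  (f : unbased_aut Delta) (hf : em_duality f) :
  [set duality_action f c | c in Sol J g] = Sol (Ad f J) g.
Proof.
apply/seteqP; split=> [_ [[phi V] S <-]|[phi' V'] S'].
  by have [[sphi sV _] _] := S; apply/(Sol_push hJ g hf sphi sV).
have [[sphi' sV' _] _] := S'; have K := duality_actionK f (existT _ phi' V').
exists (duality_action (inv_aut f) (existT _ phi' V')) => //.
apply/(Sol_push hJ g hf).
- by apply: smooth_map_comp => //; exact: bmbase_smooth.
- exact: (smooth_twoform_push (inv_aut f)).
- by move: S'; rewrite -[in X in X -> _]K.
Qed.
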